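(* Let $\Omega$ be the group of orientation-preserving $C^\infty$ diffeomorphisms of $\mathbb{S}^2$, $I=[0,1]$, and let $i(\mathrm{SO}(3)\times\Omega_1)=\{A^{-1}\circ f : A\in\mathrm{SO}(3),\ f\in\Omega_1\}\subset\Omega$. There is a diffeologically smooth map $Q: I\times\Omega\to\Omega$, $(t,f)\mapsto Q_t(f)$, such that for each $(t,f)\in I\times\Omega$ and $A\in\mathrm{SO}(3)$: (1) $Q_0(f)=f$; (2) $Q_1(f)\in i(\mathrm{SO}(3)\times\Omega_1)$; (3) $Q_t(A)=A$; (4) $Q_t(A\circ f)=A\circ Q_t(f)$.
   Context: $\mathbb{S}^2\subset\mathbb{R}^3$ is the unit sphere, $x_0=(0,0,-1)$ is the South Pole, and $\Omega_1:=\{f\in\Omega: f(x_0)=x_0 \text{ and } df|_{x_0}=\mathrm{id}_{T_{x_0}\mathbb{S}^2}\}$. $\mathrm{SO}(3)$ is regarded as a subset of $\Omega$ via its action on $\mathbb{S}^2$ by rotations. The map $i:\mathrm{SO}(3)\times\Omega_1\to\Omega$ is $(A,f)\mapsto A^{-1}\circ f$. Plots. Let $U$ range over arbitrary open subsets of Euclidean spaces of arbitrary dimension. (i) If $\Lambda$ is a manifold with corners, a map $U\to\Lambda$ is a plot if it is $C^\infty$. (ii) If $X,Y$ are manifolds with corners and $\Lambda\subset C^\infty(X,Y)$, a map $P:U\to\Lambda$ is a plot if the map $U\times X\to Y$, $(s,x)\mapsto P(s)(x)$, is $C^\infty$. (iii) If $\Lambda=\Lambda_1\times\cdots\times\Lambda_n$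 with each $\Lambda_i$ as in (i) or (ii), a map $U\to\Lambda$ is a plot if each of its components $U\to\Lambda_i$ is a plot. A map $\varphi:\Lambda\to\Gamma$ between two such spaces is diffeologically smooth if for every plot $P:U\to\Lambda$ the composite $\varphi\circ P:U\to\Gamma$ is a plot. Here $I$ is a manifold with boundary as in (i), $\Omega\subset C^\infty(\mathbb{S}^2,\mathbb{S}^2)$ is as in (ii), and $I\times\Omega$ is as in (iii). *)

(* Defs.v *)
From HB Require Import structures.
From mathcomp Require Import all_boot all_order all_algebra.
From mathcomp Require Import all_classical all_reals all_analysis.
Import numFieldNormedType.Exports.
Import Order.TTheory GRing.Theory Num.Theory.

Set Implicit Arguments.
Unset Strict Implicit.
Unset Printing Implicit Defensive.

Local Open Scope classical_set_scope.
Local Open Scope ring_scope.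

Section smooth.
Context {R : realType}.

(* Meant for open [N] and finite-dimensional [V], where it is equivalent to the
   existence and continuity on [N] of all partial derivatives of order <= k. *)
Fixpoint Ck {V W : normedModType R} (k : nat) (N : set V) (g : V -> W) : Prop :=
  if k is k'.+1 then
    (forall x, N x -> differentiable g x) /\ (forall v, Ck k' N ('D_v g))
  else forall x, N x -> {for x, continuous g}.

Definition Cinfty {V W : normedModType R} (N : set V) (g : V -> W) : Prop :=
  forall k, Ck k N g.

(* [X] is seen as a subset of [V] through the injection [e].  A map on a subset
   of a Euclidean space is C^oo iff it is, near each point of the subset, the
   restriction of a C^oo map defined on an open set of the ambient space; on an
   embedded submanifold (with corners) this is smoothness in charts. *)
Definition smooth_along {V W : normedModType R} {X : Type}
    (e : X -> V) (f : X -> W) : Prop :=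
  forall x, exists N (g : V -> W),
    [/\ open N, N (e x), Cinfty N g & forall y, N (e y) -> f y = g (e y)].

End smooth.

Section plots.
Context {R : realType}.

Definition parametrizations (L : Type) :=
  forall (n : nat) (U : set 'rV[R]_n), (U -> L) -> Prop.

Definition mfd_plots {V : normedModType R} {X : Type} (e : X -> V) :
    parametrizations X :=
  fun n U P => smooth_along (fun s : U => val s) (fun s => e (P s)).

(* [ev] presents the elements of [L] as maps from [X] to [Y]. *)
Definition map_plots {V W : normedModType R} {X Y L : Type}
    (eX : X -> V) (eY : Y -> W) (ev : L -> X -> Y) : parametrizations L :=
  fun n U P => smooth_along (fun sx : U * X => (val sx.1, eX sx.2))
                            (fun sx => eY (ev (P sx.1) sx.2)).

Definition prod_plots {L1 L2 : Type} (p1 : parametrizations L1)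
    (p2 : parametrizations L2) : parametrizations (L1 * L2)%type :=
  fun n U P => p1 n U (fun s => (P s).1) /\ p2 n U (fun s => (P s).2).

Definition diff_smooth {L G : Type} (pL : parametrizations L)
    (pG : parametrizations G) (phi : L -> G) : Prop :=
  forall (n : nat) (U : set 'rV[R]_n), open U ->
  forall P : U -> L, pL n U P -> pG n U (fun s => phi (P s)).

End plots.
Arguments parametrizations : clear implicits.

Section sphere.
Context {R : realType}.
Implicit Types u v : 'cV[R]_3.

(* The library norm on matrices is the sup norm, not the Euclidean one. *)
Definition dot u v : R := \sum_i u i 0 * v i 0.

Definition enorm u : R := Num.sqrt (dot u u).

Definition S2 := {x : 'cV[R]_3 | dot x x == 1}.

Definition smoothS2 (f : S2 -> S2) : Prop :=
  smooth_along (fun x : S2 => val x) (fun x => val (f x)).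

Definition south_pole_vec : 'cV[R]_3 := \col_i [:: 0; 0; -1]`_i.

Fact south_pole_subproof : dot south_pole_vec south_pole_vec == 1.
Proof.
rewrite /dot !big_ord_recr big_ord0 /= !mxE /=.
by rewrite !mul0r !add0r mulN1r opprK.
Qed.

Definition south_pole : S2 := exist _ south_pole_vec south_pole_subproof.

(* [south_pole] is a junk value, taken at u = 0 only. *)
Definition radial u : S2 := insubd south_pole ((enorm u)^-1 *: u).

Definition tangent (x : S2) u : Prop := dot (val x) u = 0.

(* The differential of [f] at [x], for [u] tangent at [x]: since [radial]
   is a smooth retraction of R^3 minus 0 onto S2, its differential at [x] is the
   identity on tangent vectors and [f \o radial] is a smooth extension of [f]. *)
Definition tdiff (f : S2 -> S2) (x : S2) u : 'cV[R]_3 :=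
  'D_u (fun y => val (f (radial y))) (val x).

(* A basis (u, v) of the tangent plane at [x] is positively oriented (outward
   normal first) iff [orient x u v] is positive. *)
Definition orient (x : S2) u v : R :=
  \det (row_mx (val x) (row_mx u v) : 'M[R]_3).

Definition orientation_preserving (f : S2 -> S2) : Prop :=
  forall x u v, tangent x u -> tangent x v ->
    0 < orient x u v -> 0 < orient (f x) (tdiff f x u) (tdiff f x v).

Definition diffeomorphism (f : S2 -> S2) : Prop :=
  smoothS2 f /\ exists g, [/\ smoothS2 g, cancel f g & cancel g f].

Definition Omega : set (S2 -> S2) :=
  [set f | diffeomorphism f /\ orientation_preserving f].

Definition Omega1 : set Omega :=
  [set f | val f south_pole = south_pole /\
           forall u, tangent south_pole u -> tdiff (val f) south_pole u = u].

Definition SO3 := {A : 'M[R]_3 | (A^T *m A == 1%:M) && (\det A == 1)}.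

End sphere.
Arguments S2 : clear implicits.
Arguments Omega : clear implicits.
Arguments Omega1 : clear implicits.
Arguments SO3 : clear implicits.

Section rotation_def.
Context {R : realType}.
Implicit Types (A : SO3 R) (x : S2 R).

Lemma dotE (u v : 'cV[R]_3) : dot u v = (u^T *m v) 0 0.
Proof. by rewrite mxE; apply: eq_bigr => i _; rewrite mxE. Qed.

Lemma SO3_orth A : (val A)^T *m val A = 1%:M.
Proof. by have /andP[/eqP] := valP A. Qed.

Lemma SO3_orthV A : val A *m (val A)^T = 1%:M.
Proof. exact: mulmx1C (SO3_orth A). Qed.

Lemma SO3_det A : \det (val A) = 1.
Proof. by have /andP[_ /eqP] := valP A. Qed.

Lemma dot_rot A (u v : 'cV[R]_3) : dot (val A *m u) (val A *m v) = dot u v.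
Proof.
by rewrite !dotE trmx_mul mulmxA -[_ *m val A]mulmxA SO3_orth mulmx1.
Qed.

Fact rotS2_subproof A x : dot (val A *m val x) (val A *m val x) == 1.
Proof. by rewrite dot_rot (valP x). Qed.

Definition rotS2 A x : S2 R := exist _ (val A *m val x) (rotS2_subproof A x).

Fact SO3_inv_subproof A :
  ((invmx (val A))^T *m invmx (val A) == 1%:M) && (\det (invmx (val A)) == 1).
Proof.
have -> : invmx (val A) = (val A)^T.
  have uA : val A \in unitmx by rewrite unitmxE SO3_det unitr1.
  have := congr1 (mulmx (invmx (val A))) (SO3_orthV A).
  by rewrite mulmxA mulVmx// mul1mx mulmx1.
by rewrite trmxK SO3_orthV eqxx det_tr SO3_det eqxx.
Qed.

Definition SO3_inv A : SO3 R := exist _ (invmx (val A)) (SO3_inv_subproof A).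

Lemma rotS2K A : cancel (rotS2 A) (rotS2 (SO3_inv A)).
Proof.
move=> x; apply: val_inj => /=; rewrite mulmxA mulVmx ?mul1mx//.
by rewrite unitmxE SO3_det unitr1.
Qed.

Lemma rotS2VK A : cancel (rotS2 (SO3_inv A)) (rotS2 A).
Proof.
move=> x; apply: val_inj => /=; rewrite mulmxA mulmxV ?mul1mx//.
by rewrite unitmxE SO3_det unitr1.
Qed.

End rotation_def.

Section smooth_linear.
Context {R : realType}.

Lemma near_eq_differentiable (V W : normedModType R) (f g : V -> W) x :
  (\near x, f x = g x) -> differentiable f x -> differentiable g x.
Proof.
move=> fg df.
have gx : g x = f x by rewrite (nbhs_singleton fg).
have fg0 : \forall h \near 0, f (h + x) = g (h + x).
  by move: fg; rewrite (near_shift 0)/= subr0.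
have gE : g \o shift x = cst (g x) + 'd f x +o_ 0 id.
  apply/eqaddoP => e e0; have /diff_locallyP[_ /eqaddoP/(_ _ e0)] := df.
  move=> fE; near=> h; have : f (h + x) = g (h + x) by near: h.
  rewrite gx -[X in `|X|]/(g (h + x) - (f x + 'd f x h)) => <-.
  by near: h; exact: fE.
have dgf : 'd g x = 'd f x :> (V -> W) by exact: (diff_unique (diff_continuous df) gE).
by apply/diff_locallyP; rewrite dgf; split => //; exact: diff_continuous.
Unshelve. all: by end_near. Qed.

Lemma Ck_eq (V W : normedModType R) k (N : set V) (f g : V -> W) :
  open N -> (forall x, N x -> f x = g x) -> Ck k N f -> Ck k N g.
Proof.
move=> oN; elim: k f g => [|k IH] f g fg /=.
  move=> Cf x Nx; have fx := Cf x Nx.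
  have nfg : \forall y \near x, f y = g y.
    by near=> y; apply: fg; near: y; exact: open_nbhs_nbhs.
  rewrite /prop_for /continuous_at -(fg _ Nx).
  exact: cvg_trans (near_eq_cvg nfg) fx.
have nfg x : N x -> \forall y \near x, f y = g y.
  by move=> Nx; near=> y; apply: fg; near: y; exact: open_nbhs_nbhs.
move=> [df Cf]; split=> [x Nx|v].
  exact: near_eq_differentiable (nfg x Nx) (df x Nx).
apply: IH (Cf v) => x Nx; apply: near_eq_derive; exact: nfg.
Unshelve. all: by end_near. Qed.

Lemma mulmx_differentiable m n p (A : 'M[R]_(m, n)) (x : 'M[R]_(n, p)) :
  differentiable (mulmx A) x.
Proof.
apply: linear_differentiable => /= y.
have -> : mulmx A = fun z : 'M[R]_(n, p) =>
    \sum_(k < n) \sum_(l < p) z k l *: (A *m delta_mx k l).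
  apply/funext => z; rewrite {1}[z]matrix_sum_delta mulmx_sumr.
  apply: eq_bigr => k _; rewrite mulmx_sumr; apply: eq_bigr => l _.
  by rewrite -scalemxAr.
have -> : (fun z : 'M[R]_(n, p) =>
    \sum_(k < n) \sum_(l < p) z k l *: (A *m delta_mx k l)) =
  \sum_(k < n) \sum_(l < p) (fun z : 'M[R]_(n, p) => z k l *: (A *m delta_mx k l)).
  by apply/funext => z; rewrite fct_sumE; apply: eq_bigr => k _; rewrite fct_sumE.
apply: differentiable_continuous.
apply: differentiable_sum => k; apply: differentiable_sum => l.
exact/differentiableZl/differentiable_coord.
Qed.

Lemma diff_mulmx m n p (A : 'M[R]_(m, n)) (x : 'M[R]_(n, p)) :
  'd (mulmx A) x = mulmx A :> ('M[R]_(n, p) -> 'M[R]_(m, p)).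
Proof.
apply: diff_lin => y; apply: differentiable_continuous.
exact: mulmx_differentiable.
Qed.

Lemma derive_mulmx (V : normedModType R) m n p (A : 'M[R]_(m, n))
    (g : V -> 'M[R]_(n, p)) x v :
  differentiable g x -> 'D_v (fun y => A *m g y) x = A *m 'D_v g x.
Proof.
move=> dg; have dA := mulmx_differentiable A (g x).
rewrite -[fun y => _]/(mulmx A \o g) !deriveE//; last exact: differentiable_comp.
by rewrite diff_comp//= diff_mulmx.
Qed.

Lemma derive_comp_mulmx (W : normedModType R) m n p (A : 'M[R]_(m, n))
    (g : 'M[R]_(m, p) -> W) x v :
  differentiable g (A *m x) ->
  'D_v (fun y => g (A *m y)) x = 'D_(A *m v) g (A *m x).
Proof.
move=> dg; have dA := mulmx_differentiable A x.
rewrite -[fun y => _]/(g \o mulmx A) !deriveE//; last exact: differentiable_comp.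
by rewrite diff_comp//= diff_mulmx.
Qed.

Lemma Ck_mulmx (V : normedModType R) m n p (A : 'M[R]_(m, n))
    (g : V -> 'M[R]_(n, p)) k N :
  open N -> Ck k N g -> Ck k N (fun y => A *m g y).
Proof.
move=> oN; elim: k g => [|k IH] g /=.
  move=> Cg x Nx.
  apply: (@continuous_comp _ _ _ g (mulmx A)); first exact: Cg.
  exact/differentiable_continuous/mulmx_differentiable.
move=> [dg Cg]; split=> [x Nx|v].
  apply: (@differentiable_comp _ _ _ _ g (mulmx A)); first exact: dg.
  exact: mulmx_differentiable.
apply: (Ck_eq oN _ (IH _ (Cg v))) => x Nx.
by rewrite derive_mulmx//; exact: dg.
Qed.

Lemma open_mulmx m n p (A : 'M[R]_(m, n)) (N : set 'M[R]_(m, p)) :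
  open N -> open [set y | N (A *m y)].
Proof.
apply: open_comp => x _.
exact/differentiable_continuous/mulmx_differentiable.
Qed.

Lemma Ck_comp_mulmx (W : normedModType R) m n p (A : 'M[R]_(m, n))
    (g : 'M[R]_(m, p) -> W) k N :
  open N -> Ck k N g -> Ck k [set y | N (A *m y)] (fun y => g (A *m y)).
Proof.
move=> oN; elim: k g => [|k IH] g /=.
  move=> Cg x Nx.
  apply: (@continuous_comp _ _ _ (mulmx A) g); last exact: Cg.
  exact/differentiable_continuous/mulmx_differentiable.
move=> [dg Cg]; split=> [x Nx|v].
  apply: (@differentiable_comp _ _ _ _ (mulmx A) g); last exact: dg.
  exact: mulmx_differentiable.
apply: Ck_eq (IH _ (Cg (A *m v))); first exact: open_mulmx.
by move=> x Nx; rewrite derive_comp_mulmx//; exact: dg.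
Qed.

Lemma Ck_id (V : normedModType R) k (N : set V) : Ck k N (fun x => x).
Proof.
have Cc j (c : V) : Ck j N (cst c).
  elim: j c => [|j IH] c /=; first by move=> x _; exact: cst_continuous.
  split=> [x _|v]; first exact: differentiable_cst.
  rewrite (_ : 'D_v _ = cst 0)//; apply/funext => x; exact: derive_cst.
case: k => [x _|k] /=; first exact: cvg_id.
split=> [x _|v]; first exact: ex_diff.
by rewrite (_ : 'D_v _ = cst v)//; apply/funext => x; exact: derive_id.
Qed.

End smooth_linear.

Section rotation.
Context {R : realType}.
Implicit Types (A : SO3 R) (f : S2 R -> S2 R).

Lemma smoothS2_id : smoothS2 (fun x : S2 R => x).
Proof.
move=> x; exists setT, id; split=> //; first exact: openT.
by move=> k; exact: Ck_id.
Qed.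

Lemma smoothS2_rot A f : smoothS2 f -> smoothS2 (rotS2 A \o f).
Proof.
move=> sf x; have [N [g [oN Nx Cg fg]]] := sf x.
exists N, (fun y => val A *m g y); split=> //.
  by move=> k; exact: Ck_mulmx.
by move=> y Ny /=; rewrite fg.
Qed.

Lemma smoothS2_comp_rot A f : smoothS2 f -> smoothS2 (f \o rotS2 A).
Proof.
move=> sf x; have [N [g [oN Nx Cg fg]]] := sf (rotS2 A x).
exists [set y | N (val A *m y)], (fun y => g (val A *m y)); split=> //.
- exact: open_mulmx.
- by move=> k; exact: Ck_comp_mulmx.
- by move=> y Ny /=; rewrite fg.
Qed.

Lemma diffeomorphism_rotS2 A f : diffeomorphism f -> diffeomorphism (rotS2 A \o f).
Proof.
move=> [sf [g [sg fg gf]]]; split; first exact: smoothS2_rot.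
exists (g \o rotS2 (SO3_inv A)); split; first exact: smoothS2_comp_rot.
- by move=> x /=; rewrite rotS2K.
- by move=> x /=; rewrite gf rotS2VK.
Qed.

Lemma val_radial (u : 'cV[R]_3) : u != 0 ->
  val (radial u) = (enorm u)^-1 *: u.
Proof.
move=> u0; rewrite /radial val_insubd ifT//.
have u_gt0 : 0 < dot u u.
  rewrite lt0r; apply/andP; split; last first.
    by apply: sumr_ge0 => i _; rewrite -expr2 sqr_ge0.
  apply: contra u0 => /eqP/psumr_eq0P h; apply/eqP/matrixP => i j.
  rewrite ord1 mxE; apply/eqP; rewrite -sqrf_eq0 expr2 h// => k _.
  by rewrite -expr2 sqr_ge0.
have -> : dot ((enorm u)^-1 *: u) ((enorm u)^-1 *: u) =
    (enorm u)^-1 ^+ 2 * dot u u.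
  rewrite /dot mulr_sumr; apply: eq_bigr => i _.
  by rewrite !mxE mulrACA expr2.
by rewrite exprVn sqr_sqrtr ?ltW// mulVf// gt_eqF.
Qed.

Lemma S2_neq0 (x : S2 R) : val x != 0.
Proof.
apply/eqP => x0; have := valP x; rewrite x0 dotE mulmx0 mxE.
by rewrite eq_sym oner_eq0.
Qed.

Lemma radialK (x : S2 R) : radial (val x) = x.
Proof.
apply: val_inj; rewrite val_radial ?S2_neq0// /enorm (eqP (valP x)).
by rewrite sqrtr1 invr1 scale1r.
Qed.

Lemma radial_nearE (x : S2 R) :
  \forall y \near val x, (enorm y)^-1 *: y = val (radial y).
Proof.
near=> y; rewrite val_radial//; near: y.
have /open_nbhs_nbhs : open_nbhs (val x) [set~ (0 : 'cV[R]_3)].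
  split; last by move/eqP; rewrite (negbTE (S2_neq0 x)).
  by apply: closed_openC; exact/accessible_closed_set1/hausdorff_accessible/norm_hausdorff.
by apply: filterS => y /eqP.
Unshelve. all: by end_near. Qed.

Lemma derive_coord (x u : 'cV[R]_3) i : 'D_u (fun y : 'cV[R]_3 => y i 0) x = u i 0.
Proof.
have du : derivable (fun y : 'cV[R]_3 => y) x u by exact: derivable_id.
have := derive_mx du.
by rewrite derive_id => /matrixP/(_ i 0); rewrite mxE.
Qed.

Lemma dot_sum : (fun y : 'cV[R]_3 => dot y y) =
  \sum_(i < 3) (fun y : 'cV[R]_3 => y i 0) * (fun y : 'cV[R]_3 => y i 0).
Proof. by apply/funext => y; rewrite fct_sumE. Qed.

Lemma differentiable_dot (x : 'cV[R]_3) : differentiable (fun y => dot y y) x.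
Proof.
rewrite dot_sum; apply: differentiable_sum => i.
by apply: differentiableM; exact: differentiable_coord.
Qed.

Lemma derive_dot (x u : 'cV[R]_3) : 'D_u (fun y => dot y y) x = dot x u *+ 2.
Proof.
have dc i : derivable (fun y : 'cV[R]_3 => y i 0) x u.
  exact/diff_derivable/differentiable_coord.
rewrite dot_sum derive_sum => [|i]; last by apply: derivableM; exact: dc.
rewrite /dot -sumrMnl; apply: eq_bigr => i _.
by rewrite deriveM// derive_coord mulr2n.
Qed.

Lemma differentiable_Venorm (x : S2 R) :
  differentiable (fun y => (enorm y)^-1) (val x).
Proof.
have x1 : dot (val x) (val x) = 1 by exact/eqP/(valP x).
apply: differentiableV; last by rewrite /enorm x1 sqrtr1 oner_neq0.
apply: (@differentiable_comp _ _ _ _ (fun y => dot y y) Num.sqrt).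
  exact: differentiable_dot.
rewrite x1; apply/derivable1_diffP; apply: ex_derive.
exact: is_derive1_sqrt.
Qed.

Lemma derive_Venorm (x : S2 R) u : tangent x u ->
  'D_u (fun y => (enorm y)^-1) (val x) = 0.
Proof.
move=> xu.
have x1 : dot (val x) (val x) = 1 by exact/eqP/(valP x).
rewrite (_ : (fun y => _) =
  (fun t : R => (Num.sqrt t)^-1) \o (fun y : 'cV[R]_3 => dot y y))//.
have dd := differentiable_dot (val x).
have dV : differentiable (fun t : R => (Num.sqrt t)^-1) (dot (val x) (val x)).
  rewrite x1; apply: differentiableV; last by rewrite sqrtr1 oner_neq0.
  apply/derivable1_diffP; apply: ex_derive; exact: is_derive1_sqrt.
rewrite deriveE; last exact: differentiable_comp.
by rewrite diff_comp//= -(deriveE u dd) derive_dot xu mul0rn linear0.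
Qed.

Lemma normalize_sum : (fun y : 'cV[R]_3 => (enorm y)^-1 *: y) =
  \sum_(i < 3) (fun y : 'cV[R]_3 => ((enorm y)^-1 * y i 0) *: delta_mx i 0).
Proof.
apply/funext => y; rewrite fct_sumE {2}[y]matrix_sum_delta scaler_sumr.
by apply: eq_bigr => i _; rewrite big_ord1 scalerA.
Qed.

Lemma differentiable_normalize (x : S2 R) :
  differentiable (fun y => (enorm y)^-1 *: y) (val x).
Proof.
rewrite normalize_sum; apply: differentiable_sum => i.
apply: differentiableZl; apply: differentiableM.
  exact: differentiable_Venorm.
exact: differentiable_coord.
Qed.

Lemma derive_normalize (x : S2 R) u : tangent x u ->
  'D_u (fun y => (enorm y)^-1 *: y) (val x) = u.
Proof.
move=> xu; rewrite derive_mx; last first.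
  exact/diff_derivable/differentiable_normalize.
apply/matrixP => i j; rewrite mxE ord1.
have -> : (fun y : 'cV[R]_3 => ((enorm y)^-1 *: y) i 0) =
    (fun y => (enorm y)^-1) * (fun y : 'cV[R]_3 => y i 0).
  by apply/funext => y; rewrite mxE.
rewrite deriveM; last 2 first.
- exact/diff_derivable/differentiable_Venorm.
- exact/diff_derivable/differentiable_coord.
rewrite derive_Venorm// derive_coord scaler0 addr0.
by rewrite /enorm (eqP (valP x)) sqrtr1 invr1 scale1r.
Qed.

Lemma differentiable_radial (f : S2 R -> S2 R) (x : S2 R) : smoothS2 f ->
  differentiable (fun y => val (f (radial y))) (val x).
Proof.
move=> sf; have [N [g [oN Nx Cg fg]]] := sf x.
have dr : differentiable (fun y => val (radial y)) (val x).
  exact: near_eq_differentiable (radial_nearE x) (differentiable_normalize x).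
have dg : differentiable g (val x) by have [+ _] := Cg 1%N; exact.
have gr : \forall y \near val x,
    (g \o (fun y => val (radial y))) y = val (f (radial y)).
  have Nr : \forall y \near val x, N (val (radial y)).
    have := differentiable_continuous dr; apply.
    by rewrite radialK; exact: open_nbhs_nbhs.
  by apply: filterS Nr => y Ny /=; rewrite fg.
apply: near_eq_differentiable gr _.
by apply: differentiable_comp => //; rewrite radialK.
Qed.

Lemma tdiff_id (x : S2 R) u : tangent x u -> tdiff (fun y => y) x u = u.
Proof.
move=> xu; rewrite -[RHS](derive_normalize xu).
by apply/esym/near_eq_derive; exact: radial_nearE.
Qed.

Lemma tdiff_rotS2 A f (x : S2 R) u : smoothS2 f ->
  tdiff (rotS2 A \o f) x u = val A *m tdiff f x u.
Proof.
by move=> sf; rewrite /tdiff /= derive_mulmx//; exact: differentiable_radial.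
Qed.

Lemma orient_rotS2 A (x : S2 R) u v :
  orient (rotS2 A x) (val A *m u) (val A *m v) = orient x u v.
Proof.
rewrite /orient /= -(mul_mx_row _ u v).
rewrite -[row_mx (_ *m _) _]mul_mx_row.
by rewrite -[LHS]/(\det (val A *m _)) det_mulmx SO3_det mul1r.
Qed.

Lemma Omega_id : Omega R (fun x => x).
Proof.
split.
  by split; [exact: smoothS2_id | exists id; split=> //; exact: smoothS2_id].
by move=> x u v xu xv; rewrite !tdiff_id.
Qed.

Lemma Omega_rotS2 A f : Omega R f -> Omega R (rotS2 A \o f).
Proof.
move=> [df orf]; split; first exact: diffeomorphism_rotS2.
move=> x u v xu xv uv; rewrite !tdiff_rotS2; [|exact: df.1..].
by rewrite orient_rotS2; exact: orf.
Qed.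

Definition rot_comp (A : SO3 R) (f : Omega R) : Omega R :=
  exist _ (rotS2 A \o val f) (mem_set (Omega_rotS2 A (set_mem (valP f)))).

Definition SO3_Omega (A : SO3 R) : Omega R :=
  exist _ (rotS2 A) (mem_set (Omega_rotS2 A Omega_id)).

Definition i_map (Af : SO3 R * Omega1 R) : Omega R :=
  rot_comp (SO3_inv Af.1) (val Af.2).

End rotation.

Section diffeologies.
Context {R : realType}.

Definition I01 := set_type (`[0, 1]%classic : set R).

Fact I01_0_subproof : (0 : R) \in (`[0, 1]%classic : set R).
Proof. by apply: mem_set; rewrite /= in_itv/= lexx ler01. Qed.
Fact I01_1_subproof : (1 : R) \in (`[0, 1]%classic : set R).
Proof. by apply: mem_set; rewrite /= in_itv/= lexx ler01. Qed.

Definition i0 : I01 := exist _ 0 I01_0_subproof.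
Definition i1 : I01 := exist _ 1 I01_1_subproof.

Definition I01_plots : parametrizations R I01 :=
  mfd_plots (fun t : I01 => val t : R^o).

Definition Omega_plots : parametrizations R (Omega R) :=
  map_plots (fun x : S2 R => val x) (fun y : S2 R => val y)
            (fun f : Omega R => val f).

Definition I01_Omega_plots : parametrizations R (I01 * Omega R)%type :=
  prod_plots I01_plots Omega_plots.

End diffeologies.
Arguments I01 : clear implicits.

(* Main.v *)
Require Import Defs.
From HB Require Import structures.
From mathcomp Require Import all_boot all_order all_algebra.
From mathcomp Require Import all_classical all_reals all_analysis.
From mathcomp Require Import ring lra.
Import numFieldNormedType.Exports.
Import Order.TTheory GRing.Theory Num.Theory.

(* Let D be the differential of f at the south pole x0.  Gram-Schmidt applied to
   the images under D of a fixed frame of the tangent plane at x0 yields an upper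
   triangular M with positive diagonal such that D o M is an isometry; M depends
   smoothly on f and, being a function of the first fundamental form, is unchanged
   when f is composed with a rotation.  Extended by M x0 = x0 to R^3, the segment
   M_t = (1 - t) Id + t M stays in GL+(3), so x |-> M_t x / |M_t x| is an
   orientation-preserving diffeomorphism of the sphere that fixes x0.  Put
   Q_t(f)(x) = f (M_t x / |M_t x|): the differential of Q_1(f) at x0 is D o M, so
   the rotation extending D o M and sending x0 to f(x0) brings Q_1(f) into Omega1. *)

Set Implicit Arguments.
Unset Strict Implicit.
Unset Printing Implicit Defensive.

Local Open Scope classical_set_scope.
Local Open Scope ring_scope.

(** * Calculus of C^k maps on open sets *)

Section Ck_calculus.
Context {R : realType}.
Implicit Types (V W Z : normedModType R).

Lemma CkS V W k (N : set V) (g : V -> W) : Ck k.+1 N g -> Ck k N g.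
Proof.
elim: k g => [|k IH] g [dg Dg]; first by move=> x /dg/differentiable_continuous.
by split=> [//|v]; exact: IH (Dg v).
Qed.

Lemma Ck_subset V W k (M N : set V) (g : V -> W) :
  M `<=` N -> Ck k N g -> Ck k M g.
Proof.
move=> MN; elim: k g => [|k IH] g /=; first by move=> Cg x /MN; exact: Cg.
by move=> [dg Dg]; split=> [x /MN/dg//|v]; exact: IH (Dg v).
Qed.

Lemma Ck_cst V W k (N : set V) (c : W) : Ck k N (fun=> c).
Proof.
elim: k c => [|k IH] c /=; first by move=> x _; exact: cst_continuous.
split=> [x _|v]; first exact: differentiable_cst.
rewrite (_ : 'D_v _ = fun=> 0)//; apply/funext => x; exact: derive_cst.
Qed.

Lemma differentiable_linear V W (l : V -> W) x :
  linear l -> continuous l -> differentiable l x.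
Proof.
move=> ll cl; pose lM := GRing.isLinear.Build _ _ _ _ _ ll.
pose L : {linear _ -> _} := HB.pack l lM.
exact: (@linear_differentiable _ _ _ L).
Qed.

Lemma derive_linear_comp V W Z (l : W -> Z) (g : V -> W) x v :
  linear l -> continuous l -> differentiable g x ->
  'D_v (fun y => l (g y)) x = l ('D_v g x).
Proof.
move=> ll cl dg; pose lM := GRing.isLinear.Build _ _ _ _ _ ll.
pose L : {linear _ -> _} := HB.pack l lM.
have dl : differentiable l (g x) by exact: differentiable_linear.
rewrite -[fun y => _]/(l \o g) !deriveE//; last exact: differentiable_comp.
by rewrite diff_comp//= (@diff_lin _ _ _ L).
Qed.

Lemma Ck_linear_comp V W Z (l : W -> Z) (g : V -> W) k N :
  linear l -> continuous l -> open N -> Ck k N g -> Ck k N (fun y => l (g y)).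
Proof.
move=> ll cl oN; elim: k g => [|k IH] g /=.
  move=> Cg x Nx; apply: (@continuous_comp _ _ _ g l); first exact: Cg.
  exact: cl.
move=> [dg Cg]; split=> [x Nx|v].
  apply: (@differentiable_comp _ _ _ _ g l); first exact: dg.
  exact: differentiable_linear.
apply: (Ck_eq oN _ (IH _ (Cg v))) => x Nx.
by rewrite -(derive_linear_comp v ll cl (dg x Nx)).
Qed.

Lemma Ck_add V W (f g : V -> W) k N : open N ->
  Ck k N f -> Ck k N g -> Ck k N (fun y => f y + g y).
Proof.
move=> oN; elim: k f g => [|k IH] f g /=.
  by move=> Cf Cg x Nx; apply: continuousD; [exact: Cf|exact: Cg].
move=> [df Df] [dg Dg]; split=> [x Nx|v].
  by apply: differentiableD; [exact: df|exact: dg].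
apply: (Ck_eq oN _ (IH _ _ (Df v) (Dg v))) => x Nx.
by rewrite -deriveD//; apply: diff_derivable; [exact: df|exact: dg].
Qed.

Lemma Ck_sum V W n (f : 'I_n -> V -> W) k N : open N ->
  (forall i, Ck k N (f i)) -> Ck k N (fun y => \sum_i f i y).
Proof.
move=> oN; elim: n f => [|n IH] f Cf.
  by apply: Ck_eq (@Ck_cst _ _ k N 0) => // x _; rewrite big_ord0.
apply: (Ck_eq oN (f := fun y => f ord0 y + \sum_i f (lift ord0 i) y)).
  by move=> x _; rewrite big_ord_recl.
by apply: Ck_add => //; exact: IH.
Qed.

Lemma scale_is_bilinear W : bilinear_for
  (GRing.Scale.Law.clone _ _ *:%R _) (GRing.Scale.Law.clone _ _ *:%R _)
  (@GRing.scale R W).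
Proof.
split=> [w|a] b x y /=; first by rewrite scalerDl scalerA.
by rewrite scalerDr !scalerA mulrC.
Qed.

(** Scaling is a continuous bilinear map, so the product rule is the chain rule applied to it and to
    the pair [(f, g)]. *)
Lemma is_diff_scale V W (f : V -> R) (g : V -> W) x :
  differentiable f x -> differentiable g x ->
  is_diff x (fun y => f y *: g y) (fun v => f x *: 'd g x v + 'd f x v *: g x).
Proof.
move=> df dg; pose bM := bilinear_isBilinear.Build R R W W _ _ (@GRing.scale R W)
  (@scale_is_bilinear W).
pose B : {bilinear R -> W -> W} := HB.pack (@GRing.scale R W) bM.
have cB : continuous (fun p : R * W => B p.1 p.2) by move=> p; exact: scale_continuous.
have dB := differentiable_bilin (f := B) (f x, g x) cB.
have dp : differentiable (fun y => (f y, g y)) x by exact: differentiable_pair.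
rewrite -[fun y => f y *: _]/((fun p : R * W => B p.1 p.2) \o (fun y => (f y, g y))).
apply: DiffDef; first exact: differentiable_comp.
by rewrite diff_comp// diff_bilin//= diff_pair.
Qed.

Lemma Ck_scale V W (f : V -> R) (g : V -> W) k N : open N ->
  Ck k N f -> Ck k N g -> Ck k N (fun y => f y *: g y).
Proof.
move=> oN; elim: k f g => [|k IH] f g.
  by move=> Cf Cg x Nx; apply: cvgZ; [exact: Cf|exact: Cg].
move=> Cf Cg; have [df Df] := Cf; have [dg Dg] := Cg; split=> [x Nx|v].
  by have [] := is_diff_scale (df x Nx) (dg x Nx).
apply: (Ck_eq oN (f := fun x => f x *: 'D_v g x + 'D_v f x *: g x)).
  move=> x Nx; have [dfg fgE] := is_diff_scale (df x Nx) (dg x Nx).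
  by rewrite [in RHS]deriveE// fgE !deriveE//; [exact: df|exact: dg].
(* Each term of the product rule keeps one undifferentiated factor, which is lowered from order
   [k.+1] to [k] to meet the induction hypothesis. *)
by apply: Ck_add => //; apply: IH; [exact: CkS Cf|exact: Dg|exact: Df|exact: CkS Cg].
Qed.

Lemma Ck_mul V (f g : V -> R) k N : open N ->
  Ck k N f -> Ck k N g -> Ck k N (fun y => f y * g y).
Proof. exact: Ck_scale. Qed.

(** The derivative of 1/f is a product of 1/f with itself and with a derivative of f, so order [k]
    of 1/f gives order [k.+1]. *)
Lemma Ck_inv V (f : V -> R) k N : open N -> (forall x, N x -> f x != 0) ->
  Ck k N f -> Ck k N (fun y => (f y)^-1).
Proof.
move=> oN f0; elim: k => [|k IH].
  by move=> Cf x Nx; apply: continuousV; [exact: f0|exact: Cf].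
move=> Cf; have [df Df] := Cf; split=> [x Nx|v].
  by apply: differentiableV; [exact: df|exact: f0].
apply: (Ck_eq oN (f := fun x => - ((f x)^-1 * (f x)^-1) * 'D_v f x)).
  move=> x Nx; rewrite deriveV ?f0//; last exact/diff_derivable/df.
  by rewrite expr2 invfM.
have CV := IH (CkS Cf).
apply: Ck_mul => //; last exact: Df.
apply: (Ck_eq oN (f := fun x => (-1 : R) * ((f x)^-1 * (f x)^-1))).
  by move=> x _; rewrite mulN1r.
by apply: Ck_mul => //; [exact: Ck_cst|exact: Ck_mul].
Qed.

Lemma is_diff_sqrt V (f : V -> R) x : differentiable f x -> 0 < f x ->
  is_diff x (fun y => Num.sqrt (f y)) (fun v => (2 * Num.sqrt (f x))^-1 * 'd f x v).
Proof.
move=> df f0; have [/derivable1_diffP ds sE] := is_derive1_sqrt f0.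
apply: DiffDef; first exact: (@differentiable_comp _ _ _ _ f Num.sqrt).
rewrite -[fun y => _]/(Num.sqrt \o f) (diff_comp df ds); apply/funext => v /=.
(* A differential on the real line is determined by its value at 1, which is the derivative of the
   square root. *)
rewrite -sE deriveE// -[X in 'd _ _ X](mulr1 ('d f x v)).
by rewrite -[_ * 1]/(_ *: 1) linearZ /= mulrC.
Qed.

Lemma Ck_sqrt V (f : V -> R) k N : open N -> (forall x, N x -> 0 < f x) ->
  Ck k N f -> Ck k N (fun y => Num.sqrt (f y)).
Proof.
move=> oN f0; elim: k => [|k IH].
  move=> Cf x Nx; apply: (@continuous_comp _ _ _ f Num.sqrt); first exact: Cf.
  exact: sqrt_continuous.
move=> Cf; have [df Df] := Cf; split=> [x Nx|v].
  by have [] := is_diff_sqrt (df x Nx) (f0 x Nx).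
apply: (Ck_eq oN (f := fun x => (2 * Num.sqrt (f x))^-1 * 'D_v f x)).
  move=> x Nx; have [ds sE] := is_diff_sqrt (df x Nx) (f0 x Nx).
  by rewrite [in RHS]deriveE// sE deriveE//; exact: df.
apply: Ck_mul => //; last exact: Df.
apply: Ck_inv => //.
  by move=> x Nx; rewrite mulf_neq0 ?pnatr_eq0// gt_eqF// sqrtr_gt0 f0.
by apply: Ck_mul => //; [exact: Ck_cst|exact: IH (CkS Cf)].
Qed.

(** Finite dimensionality in the form the chain rule uses: finitely many fixed directions that span,
    with linear and continuous coefficients. The family [e] may be redundant. *)
Definition finite_coordinates W := exists n (e : 'I_n -> W) (c : 'I_n -> W -> R),
  (forall i, linear (c i) /\ continuous (c i)) /\
  forall w, w = \sum_i c i w *: e i.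

(** [Ck] controls derivatives of [h] along fixed directions only, while the chain rule
    differentiates [h] along the moving direction ['D_v g x]. Expanding that direction in the fixed
    [e i] gives a finite sum of products to which the induction applies. *)
Lemma Ck_comp V W Z (h : W -> Z) (g : V -> W) k M N :
  finite_coordinates W -> open M -> open N -> (forall x, M x -> N (g x)) ->
  Ck k N h -> Ck k M g -> Ck k M (fun x => h (g x)).
Proof.
move=> [n [e [c [lc eE]]]] oM oN MN; elim: k h => [|k IH] h.
  move=> Ch Cg x Mx; apply: (@continuous_comp _ _ _ g h); first exact: Cg.
  exact/Ch/MN.
move=> [dh Dh] Cg; have [dg Dg] := Cg; split=> [x Mx|v].
  apply: (@differentiable_comp _ _ _ _ g h); first exact: dg.
  exact/dh/MN.
apply: (Ck_eq oM (f := fun x => \sum_i c i ('D_v g x) *: 'D_(e i) h (g x))).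
  move=> x Mx; have dhx := dh _ (MN _ Mx); have dgx := dg _ Mx.
  have -> : 'D_v (fun x => h (g x)) x = 'd h (g x) ('D_v g x).
    rewrite -[fun x => _]/(h \o g) deriveE; last exact: differentiable_comp.
    by rewrite diff_comp//= -(deriveE v dgx).
  rewrite {2}(eE ('D_v g x)) linear_sum.
  by apply: eq_bigr => i _; rewrite linearZ -deriveE.
apply: Ck_sum => // i; apply: Ck_scale => //.
  have [li ci] := lc i; apply: (Ck_linear_comp li ci oM); exact: Dg.
by apply: IH (Dh _) (CkS Cg).
Qed.

Lemma finite_coordinates_mx m n : finite_coordinates 'M[R]_(m, n).
Proof.
pose p (k : 'I_(#|{: 'I_m * 'I_n}|)) := enum_val k.
exists _, (fun k => delta_mx (p k).1 (p k).2), (fun k (w : 'M[R]_(m, n)) => w (p k).1 (p k).2).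
split=> [k|w]; first split.
- by move=> a u v; rewrite !mxE.
- exact: coord_continuous.
rewrite {1}[w]matrix_sum_delta pair_big/=.
by rewrite (reindex p)//; exact/onW_bij/enum_val_bij.
Qed.

Lemma finite_coordinates_prod W Z :
  finite_coordinates W -> finite_coordinates Z ->
  finite_coordinates (W * Z)%type.
Proof.
move=> [n [e [c [lc eE]]]] [m [e' [c' [lc' eE']]]].
pose E (k : 'I_(n + m)) : W * Z := match fintype.split k with
  | inl i => (e i, 0) | inr j => (0, e' j) end.
pose C (k : 'I_(n + m)) (p : W * Z) := match fintype.split k with
  | inl i => c i p.1 | inr j => c' j p.2 end.
exists _, E, C; split=> [k|[w z]].
  rewrite /C; case: fintype.split => i; split.
  - by move=> a u v /=; have [-> _] := lc i.
  - move=> x; apply: (@continuous_comp _ _ _ fst (c i)); first exact: cvg_fst.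
    by have [_] := lc i; exact.
  - by move=> a u v /=; have [-> _] := lc' i.
  - move=> x; apply: (@continuous_comp _ _ _ snd (c' i)); first exact: cvg_snd.
    by have [_] := lc' i; exact.
rewrite big_split_ord/=.
under eq_bigr => i _ do rewrite /E /C (unsplitK (inl i)) /=.
under [X in _ + X]eq_bigr => i _ do rewrite /E /C (unsplitK (inr i)) /=.
rewrite {1}(eE w) {1}(eE' z).
have -> : (\sum_i c i w *: e i, \sum_i c' i z *: e' i) =
    (\sum_i c i w *: e i, 0) + (0, \sum_i c' i z *: e' i) :> W * Z.
  by congr pair; rewrite ?addr0 ?add0r.
congr (_ + _).
  apply: (big_rec2 (fun y1 y2 => (y1, 0) = y2 :> W * Z)) => // i y1 _ _ <-.
  by rewrite [RHS]surjective_pairing /= scaler0 add0r.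
apply: (big_rec2 (fun y1 y2 => (0, y1) = y2 :> W * Z)) => // i y1 _ _ <-.
by rewrite [RHS]surjective_pairing /= scaler0 add0r.
Qed.

End Ck_calculus.

(** * Maps that are smooth near a point *)

Section smooth_at.
Context {R : realType}.
Implicit Types (V W Z : normedModType R).

(** One neighbourhood serves all orders of differentiability, so the property passes to derivatives
    and depends only on the germ of [g] at [x]. *)
Definition smooth_at V W (x : V) (g : V -> W) :=
  exists2 N, open_nbhs x N & Cinfty N g.

Lemma smooth_at_restrict V W (x : V) (g : V -> W) (P : set V) :
  smooth_at x g -> (\forall y \near x, P y) ->
  exists N, [/\ open_nbhs x N, Cinfty N g & N `<=` P].
Proof.
move=> [N [oN Nx] Cg] nP; exists (N `&` P°); split.
- by split; [apply: openI => //; exact: open_interior | split].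
- by move=> k; apply: Ck_subset (Cg k); exact: subIsetl.
- by move=> y [_ /interior_subset].
Qed.

Lemma smooth_at_eq V W (x : V) (f g : V -> W) :
  (\forall y \near x, f y = g y) -> smooth_at x f -> smooth_at x g.
Proof.
move=> fg sf; have [N [oN Cf Nfg]] := smooth_at_restrict sf fg.
by exists N => // k; apply: Ck_eq (Cf k) => //; case: oN.
Qed.

Lemma smooth_at_differentiable V W (x : V) (g : V -> W) :
  smooth_at x g -> differentiable g x.
Proof. by move=> [N [_ Nx] /(_ 1%N)[+ _]]; exact. Qed.

Lemma smooth_at_continuous V W (x : V) (g : V -> W) :
  smooth_at x g -> {for x, continuous g}.
Proof. by move/smooth_at_differentiable/differentiable_continuous. Qed.

Lemma smooth_at_near V W (x : V) (g : V -> W) (P : set W) :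
  smooth_at x g -> (\forall z \near g x, P z) -> \forall y \near x, P (g y).
Proof. by move=> sg nP; have := smooth_at_continuous sg; exact. Qed.

Lemma smooth_at_derive V W (x v : V) (g : V -> W) :
  smooth_at x g -> smooth_at x ('D_v g).
Proof. by move=> [N oN Cg]; exists N => // k; have [_ +] := Cg k.+1; exact. Qed.

Lemma smooth_at_cst V W (x : V) (c : W) : smooth_at x (fun=> c).
Proof. by exists setT => [|k]; [split=> //; exact: openT|exact: Ck_cst]. Qed.

Lemma smooth_at_id V (x : V) : smooth_at x (fun y => y).
Proof. by exists setT => [|k]; [split=> //; exact: openT|exact: Ck_id]. Qed.

Lemma smooth_at_linear_comp V W Z (l : W -> Z) (g : V -> W) x :
  linear l -> continuous l -> smooth_at x g -> smooth_at x (fun y => l (g y)).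
Proof.
move=> ll cl [N oN Cg]; exists N => // k.
by apply: Ck_linear_comp => //; case: oN.
Qed.

Lemma smooth_at_add V W (f g : V -> W) x :
  smooth_at x f -> smooth_at x g -> smooth_at x (fun y => f y + g y).
Proof.
move=> [M [oM Mx] Cf] [N [oN Nx] Cg]; exists (M `&` N).
  by split; [exact: openI|].
move=> k; apply: Ck_add; first exact: openI.
  by apply: Ck_subset (Cf k); exact: subIsetl.
by apply: Ck_subset (Cg k); exact: subIsetr.
Qed.

Lemma smooth_at_sum V W n (f : 'I_n -> V -> W) x :
  (forall i, smooth_at x (f i)) -> smooth_at x (fun y => \sum_i f i y).
Proof.
elim: n f => [|n IH] f sf.
  apply: smooth_at_eq (smooth_at_cst x (0 : W)).
  by apply: nearW => y; rewrite big_ord0.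
apply: (smooth_at_eq (f := fun y => f ord0 y + \sum_i f (lift ord0 i) y)).
  by apply: nearW => y; rewrite big_ord_recl.
by apply: smooth_at_add => //; exact: IH.
Qed.

Lemma smooth_at_scale V W (f : V -> R) (g : V -> W) x :
  smooth_at x f -> smooth_at x g -> smooth_at x (fun y => f y *: g y).
Proof.
move=> [M [oM Mx] Cf] [N [oN Nx] Cg]; exists (M `&` N).
  by split; [exact: openI|].
move=> k; apply: Ck_scale; first exact: openI.
  by apply: Ck_subset (Cf k); exact: subIsetl.
by apply: Ck_subset (Cg k); exact: subIsetr.
Qed.

Lemma smooth_at_mul V (f g : V -> R) x :
  smooth_at x f -> smooth_at x g -> smooth_at x (fun y => f y * g y).
Proof. exact: smooth_at_scale. Qed.

Lemma smooth_at_inv V (f : V -> R) x :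
  f x != 0 -> smooth_at x f -> smooth_at x (fun y => (f y)^-1).
Proof.
move=> fx0 sf.
have nf : \forall y \near x, f y != 0.
  apply: (smooth_at_near (P := [set z | z != 0]) sf).
  by apply: open_nbhs_nbhs; split=> //; exact: open_neq.
have [N [oN Cf Nf]] := smooth_at_restrict sf nf; exists N => // k.
by apply: Ck_inv => //; case: oN.
Qed.

Lemma smooth_at_sqrt V (f : V -> R) x :
  0 < f x -> smooth_at x f -> smooth_at x (fun y => Num.sqrt (f y)).
Proof.
move=> fx0 sf.
have nf : \forall y \near x, 0 < f y.
  apply: (smooth_at_near (P := [set z : R | 0 < z]) sf).
  by apply: open_nbhs_nbhs; split=> //; exact: open_gt.
have [N [oN Cf Nf]] := smooth_at_restrict sf nf; exists N => // k.
by apply: Ck_sqrt => //; case: oN.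
Qed.

Lemma smooth_at_comp V W Z (h : W -> Z) (g : V -> W) x :
  finite_coordinates W -> smooth_at (g x) h -> smooth_at x g ->
  smooth_at x (fun y => h (g y)).
Proof.
move=> fW [M oM Ch] sg.
have ng : \forall y \near x, M (g y).
  exact: (smooth_at_near (P := M) sg (open_nbhs_nbhs oM)).
have [N [oN Cg Nf]] := smooth_at_restrict sg ng; exists N => // k.
apply: Ck_comp (Ch k) (Cg k) => //; by [case: oN|case: oM].
Qed.

Lemma smooth_at_coord V m n (f : V -> 'M[R]_(m, n)) i j x :
  smooth_at x f -> smooth_at x (fun y => f y i j).
Proof.
apply: (smooth_at_linear_comp (l := fun w : 'M[R]_(m, n) => w i j)).
  by move=> a u v; rewrite !mxE.
exact: coord_continuous.
Qed.

Lemma smooth_at_mx V m n (f : V -> 'M[R]_(m, n)) x :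
  (forall i j, smooth_at x (fun y => f y i j)) -> smooth_at x f.
Proof.
move=> sf; apply: (smooth_at_eq (f := fun y => \sum_i \sum_j f y i j *: delta_mx i j)).
  by apply: nearW => y; rewrite -matrix_sum_delta.
apply: smooth_at_sum => i; apply: smooth_at_sum => j.
by apply: smooth_at_scale; [exact: sf|exact: smooth_at_cst].
Qed.

Lemma smooth_at_mulmx V m n p (A : V -> 'M[R]_(m, n)) (B : V -> 'M[R]_(n, p)) x :
  smooth_at x A -> smooth_at x B -> smooth_at x (fun y => A y *m B y).
Proof.
move=> sA sB; apply: smooth_at_mx => i j.
apply: (smooth_at_eq (f := fun y => \sum_k A y i k * B y k j)).
  by apply: nearW => y; rewrite mxE.
by apply: smooth_at_sum => k; apply: smooth_at_mul; exact: smooth_at_coord.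
Qed.

Lemma smooth_at_fst V W Z (f : V -> W * Z) x :
  smooth_at x f -> smooth_at x (fun y => (f y).1).
Proof. by apply: (smooth_at_linear_comp (l := fst)) => // p; exact: cvg_fst. Qed.

Lemma smooth_at_snd V W Z (f : V -> W * Z) x :
  smooth_at x f -> smooth_at x (fun y => (f y).2).
Proof. by apply: (smooth_at_linear_comp (l := snd)) => // p; exact: cvg_snd. Qed.

Lemma smooth_at_pair V W Z (f : V -> W) (g : V -> Z) x :
  smooth_at x f -> smooth_at x g -> smooth_at x (fun y => (f y, g y)).
Proof.
move=> sf sg; apply: (smooth_at_eq (f := fun y => (f y, 0 : Z) + (0 : W, g y))).
  by apply: nearW => y; rewrite [LHS]surjective_pairing /= addr0 add0r.
apply: smooth_at_add.
  apply: (smooth_at_linear_comp (l := fun w => (w, 0 : Z))) sf.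
    by move=> a u v; rewrite [RHS]surjective_pairing /= scaler0 addr0.
  by move=> w; apply: cvg_pair; [exact: cvg_id|exact: cvg_cst].
apply: (smooth_at_linear_comp (l := fun z => (0 : W, z))) sg.
  by move=> a u v; rewrite [RHS]surjective_pairing /= scaler0 addr0.
by move=> w; apply: cvg_pair; [exact: cvg_cst|exact: cvg_id].
Qed.

(** Turns the explicit neighbourhoods of [smooth_along] into filters. The nearby [z] ranges over the
    ambient space, and the agreement is vacuous when [z] is not in the image of [e]. *)
Lemma smooth_alongP V W (X : Type) (e : X -> V) (f : X -> W) :
  smooth_along e f <-> forall x, exists2 g, smooth_at (e x) g &
    \forall z \near e x, forall y, e y = z -> f y = g z.
Proof.
split=> sf x.
  have [N [g [oN Nx Cg fg]]] := sf x; exists g; first by exists N.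
  have : \forall z \near e x, N z by exact: open_nbhs_nbhs.
  by apply: filterS => z Nz y yz; rewrite -yz fg// yz.
have [g sg nfg] := sf x.
have [N [[oN Nx] Cg Nfg]] := smooth_at_restrict sg nfg.
by exists N, g; split=> // y /Nfg; exact.
Qed.

End smooth_at.

(** * The determinant of a 3 by 3 matrix in coordinates *)

Section det3.
Context {R : comPzRingType}.

Lemma det_mx33 (A : 'M[R]_3) : \det A =
  A 0 0 * (A 1 1 * A 2%:R 2%:R - A 2%:R 1 * A 1 2%:R)
  - A 1 0 * (A 0 1 * A 2%:R 2%:R - A 2%:R 1 * A 0 2%:R)
  + A 2%:R 0 * (A 0 1 * A 1 2%:R - A 1 1 * A 0 2%:R).
Proof.
rewrite (expand_det_col _ 0) !big_ord_recl big_ord0 /cofactor.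
rewrite !(expand_det_col _ 0) !big_ord_recl !big_ord0 /cofactor !det_mx11 !mxE /=.
(* Indexing the entries by natural numbers lets computation identify the different ordinal
   expressions of the same index, as [ring] requires. *)
have [a aE] : exists a : nat -> nat -> R, forall i j, A i j = a i j.
  by exists (fun k l => A (inord k) (inord l)) => i j; rewrite !inord_val.
rewrite !aE /= /bump /= !add0n !add1n ?addn0 ?expr0 ?expr1 ?sqrrN ?expr1n.
ring.
Qed.
End det3.

(** * Homogeneous extensions of sphere maps, and the action of matrices on rays *)

Section sphere_maps.
Context {R : realType}.
Implicit Types (u v w y : 'cV[R]_3) (x : S2 R) (f : S2 R -> S2 R) (M : 'M[R]_3).

Lemma dot3 u v :
  dot u v = u 0 0 * v 0 0 + u 1 0 * v 1 0 + u 2%:R 0 * v 2%:R 0.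
Proof.
rewrite /dot !big_ord_recl big_ord0 addr0 addrA.
by congr (_ * _ + _ * _ + _ * _); [congr (u _ _)|congr (v _ _)|congr (u _ _)|congr (v _ _)];
  exact: val_inj.
Qed.

Lemma det_col3 u v w : \det (row_mx u (row_mx v w) : 'M[R]_3) =
  u 0 0 * (v 1 0 * w 2%:R 0 - v 2%:R 0 * w 1 0)
  - u 1 0 * (v 0 0 * w 2%:R 0 - v 2%:R 0 * w 0 0)
  + u 2%:R 0 * (v 0 0 * w 1 0 - v 1 0 * w 0 0).
Proof.
have rE i : ((row_mx u (row_mx v w) : 'M[R]_3) i 0 = u i 0) *
  ((row_mx u (row_mx v w) : 'M[R]_3) i 1 = v i 0) *
  ((row_mx u (row_mx v w) : 'M[R]_3) i 2%:R = w i 0).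
  have -> : 2%:R = @rshift 1 2 (@rshift 1 1 0) :> 'I_3 by exact: val_inj.
  have -> : 0 = @lshift 1 2 0 :> 'I_3 by exact: val_inj.
  have -> : 1 = @rshift 1 2 (@lshift 1 1 0) :> 'I_3 by exact: val_inj.
  by rewrite (row_mxEl u) !(row_mxEr u) (row_mxEl v) (row_mxEr v).
by rewrite det_mx33 !rE; ring.
Qed.

Lemma enormZ (c : R) y : 0 <= c -> enorm (c *: y) = c * enorm y.
Proof.
move=> c0; have -> : c * enorm y = Num.sqrt (c ^+ 2 * dot y y).
  by rewrite sqrtrM ?sqr_ge0// sqrtr_sqr ger0_norm.
by congr Num.sqrt; rewrite !dot3 !mxE; ring.
Qed.

Lemma dot_gt0 y : y != 0 -> 0 < dot y y.
Proof.
move=> y0; rewrite lt_neqAle eq_sym; apply/andP; split; last first.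
  by apply: sumr_ge0 => i _; rewrite -expr2 sqr_ge0.
apply: contra y0 => /eqP/psumr_eq0P h; apply/eqP/matrixP => i j.
rewrite ord1 mxE; apply/eqP; rewrite -sqrf_eq0 expr2 h// => k _.
by rewrite -expr2 sqr_ge0.
Qed.

Lemma enorm_gt0 y : y != 0 -> 0 < enorm y.
Proof. by move=> y0; rewrite sqrtr_gt0 dot_gt0. Qed.

Lemma radialZ (c : R) y : 0 < c -> radial (c *: y) = radial y.
Proof.
move=> c0; rewrite /radial enormZ ?ltW// invfM scalerA mulrC mulrA divff ?mul1r//.
exact: lt0r_neq0.
Qed.

Lemma radialE y : y != 0 -> enorm y *: val (radial y) = y.
Proof.
move=> y0; rewrite val_radial// scalerA divff ?scale1r//.
by rewrite lt0r_neq0// enorm_gt0.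
Qed.

Lemma near_neq0 y : y != 0 -> \forall z \near y, z != 0.
Proof.
move=> y0; have : open_nbhs y [set~ (0 : 'cV[R]_3)].
  split; last by move/eqP; rewrite (negbTE y0).
  by apply: closed_openC; exact/accessible_closed_set1/hausdorff_accessible/norm_hausdorff.
by move/open_nbhs_nbhs; apply: filterS => z /eqP.
Qed.

Lemma smooth_at_radial y : y != 0 -> smooth_at y (fun z => val (radial z)).
Proof.
move=> y0; apply: (smooth_at_eq (f := fun z => (enorm z)^-1 *: z)).
  by apply: filterS (near_neq0 y0) => z z0; rewrite val_radial.
apply: smooth_at_scale; last exact: smooth_at_id.
apply: smooth_at_inv; first by rewrite lt0r_neq0// enorm_gt0.
apply: smooth_at_sqrt; first exact: dot_gt0.
apply: smooth_at_sum => i.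
by apply: smooth_at_mul; apply: smooth_at_coord; exact: smooth_at_id.
Qed.

(** The extension of [f] to nonzero vectors that is constant on rays; [tdiff f x u] is by conversion
    its derivative at [val x] along [u]. *)
Definition extend f y : 'cV[R]_3 := val (f (radial y)).

Lemma extendZ f (c : R) y : 0 < c -> extend f (c *: y) = extend f y.
Proof. by move=> c0; rewrite /extend radialZ. Qed.

(** A local ambient extension of [f] near [radial y], composed with the smooth retraction [radial],
    agrees with [extend f] near [y]. *)
Lemma smooth_extend f y : smoothS2 f -> y != 0 -> smooth_at y (extend f).
Proof.
move=> /smooth_alongP/(_ (radial y))[g sg gf] y0.
have sr := smooth_at_radial y0.
apply: (smooth_at_eq (f := fun z => g (val (radial z)))).
  by have := smooth_at_near sr gf; apply: filterS => z /(_ _ erefl).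
exact: smooth_at_comp (finite_coordinates_mx _ _) sg sr.
Qed.

Lemma smoothS2_extend f :
  (forall x, smooth_at (val x) (extend f)) -> smoothS2 f.
Proof.
move=> sf; apply/smooth_alongP => x; exists (extend f) => //.
by apply: (@filterE _ (nbhs (val x))) => z y <-; rewrite /extend radialK.
Qed.

Lemma differentiable_extend f y : smoothS2 f -> y != 0 ->
  differentiable (extend f) y.
Proof. by move=> sf y0; exact/smooth_at_differentiable/smooth_extend. Qed.

(** The derivative of a map homogeneous of degree 0 is homogeneous of degree -1. The factor comes
    from the chain rule through multiplication by [c^-1]. *)
Lemma derive_extendZ f (c : R) y w : smoothS2 f -> y != 0 -> 0 < c ->
  'D_w (extend f) (c *: y) = c^-1 *: 'D_w (extend f) y.
Proof.
move=> sf y0 c0; have ci0 : 0 < c^-1 by rewrite invr_gt0.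
have cK z : (c^-1)%:M *m (c *: z) = z.
  by rewrite mul_scalar_mx scalerA mulVf ?scale1r// lt0r_neq0.
have dy := differentiable_extend sf y0.
have -> : extend f = fun z => extend f ((c^-1)%:M *m z).
  by apply/funext => z; rewrite mul_scalar_mx extendZ.
rewrite derive_comp_mulmx ?cK//.
have -> : (fun z => extend f ((c^-1)%:M *m z)) = extend f.
  by apply/funext => z; rewrite mul_scalar_mx extendZ.
by rewrite mul_scalar_mx !deriveE// linearZ.
Qed.

Lemma derive_extend_radial f y : 'D_y (extend f) y = 0.
Proof.
apply: cvg_lim => //; apply: cvg_near_cst.
(* For these [h] the point [h *: y + y] stays on the ray of [y], so the difference quotient is 0. *)
have : \forall h \near (0 : R), 0 < h + 1.
  have [] := @nbhs_normP R R (0 : R) (fun h => 0 < h + 1) => _; apply.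
  exists 1; rewrite //= => h; rewrite /ball_ /= sub0r normrN => h1.
  have := ler_norm (- h); rewrite normrN; lra.
move=> h1; apply: nbhs_dnbhs; apply: filterS h1 => h h1 /=.
have -> : h *: y + y = (h + 1) *: y by rewrite scalerDl scale1r.
by rewrite extendZ// subrr scaler0.
Qed.

Lemma dot_orthogonal_part u w :
  dot u (w - dot u w *: u) = dot u w * (1 - dot u u).
Proof. by rewrite !dot3 !mxE; ring. Qed.

Lemma tangent_decomp x w : tangent x (w - dot (val x) w *: val x).
Proof.
by rewrite /tangent dot_orthogonal_part (eqP (valP x)) subrr mulr0.
Qed.

(** The derivative along the radial part of [w] vanishes, which leaves the tangential projection. *)
Lemma derive_extend_tangent f x w : smoothS2 f ->
  'D_w (extend f) (val x) = tdiff f x (w - dot (val x) w *: val x).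
Proof.
move=> sf; have dx := differentiable_extend sf (S2_neq0 x).
rewrite -[tdiff _ _ _]/('D__ (extend f) (val x)) !deriveE// linearB linearZ/=.
by rewrite -[in X in _ - X]deriveE// derive_extend_radial scaler0 subr0.
Qed.

Lemma smoothS2_comp f g : smoothS2 f -> smoothS2 g -> smoothS2 (f \o g).
Proof.
move=> sf sg; apply: smoothS2_extend => x.
apply: (smooth_at_eq (f := fun y => extend f (extend g y))).
  by apply: (@filterE _ (nbhs (val x))) => z; rewrite /extend radialK.
apply: smooth_at_comp; first exact: finite_coordinates_mx.
  by apply: smooth_extend sf _; exact: S2_neq0.
by apply: smooth_extend sg _; exact: S2_neq0.
Qed.

Definition linS2 M x : S2 R := radial (M *m val x).

Lemma unitmx_mul_neq0 M y : M \in unitmx -> y != 0 -> M *m y != 0.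
Proof.
move=> uM; apply: contra => /eqP My; rewrite -[y]mul1mx -(mulVmx uM) -mulmxA My.
by rewrite mulmx0.
Qed.

Lemma linS2K M : M \in unitmx -> cancel (linS2 M) (linS2 (invmx M)).
Proof.
move=> uM x; have Mx0 := unitmx_mul_neq0 uM (S2_neq0 x).
rewrite /linS2 val_radial// -scalemxAr mulmxA mulVmx// mul1mx.
by rewrite radialZ ?radialK// invr_gt0 enorm_gt0.
Qed.

Lemma linS2VK M : M \in unitmx -> cancel (linS2 (invmx M)) (linS2 M).
Proof. move=> uM x; have := @linS2K (invmx M) _ x; rewrite invmxK; apply.
by rewrite unitmx_inv. Qed.

(** The normalization in [linS2] is absorbed by homogeneity. Derivatives of [f \o linS2 M] thus need
    only the chain rule for a linear map. *)
Lemma extend_linS2 f M y : y != 0 -> extend (f \o linS2 M) y = extend f (M *m y).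
Proof.
move=> y0; rewrite /extend /= /linS2 val_radial// -scalemxAr radialZ//.
by rewrite invr_gt0 enorm_gt0.
Qed.

Lemma smoothS2_linS2 f M : M \in unitmx -> smoothS2 f -> smoothS2 (f \o linS2 M).
Proof.
move=> uM sf; apply: smoothS2_extend => x.
apply: (smooth_at_eq (f := fun y => extend f (M *m y))).
  by apply: filterS (near_neq0 (S2_neq0 x)) => z z0; rewrite extend_linS2.
apply: smooth_at_comp; first exact: finite_coordinates_mx.
  by apply: smooth_extend sf _; exact: unitmx_mul_neq0 uM (S2_neq0 x).
by apply: smooth_at_mulmx; [exact: smooth_at_cst|exact: smooth_at_id].
Qed.

Lemma tdiff_linS2 f M x u : M \in unitmx -> smoothS2 f ->
  tdiff (f \o linS2 M) x u = 'D_(M *m u) (extend f) (M *m val x).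
Proof.
move=> uM sf; have Mx0 := unitmx_mul_neq0 uM (S2_neq0 x).
rewrite -derive_comp_mulmx; last exact: differentiable_extend.
apply: near_eq_derive.
by apply: filterS (near_neq0 (S2_neq0 x)) => z z0; rewrite -extend_linS2.
Qed.

End sphere_maps.

(** * Matrices of positive determinant act on the group of diffeomorphisms *)

Section frames.
Context {R : realType}.
Implicit Types (u v w y p : 'cV[R]_3) (x : S2 R) (f : S2 R -> S2 R).

(** Subtracting multiples of the first column leaves the determinant unchanged. With [s] and [t] the
    components along a unit vector [p], the last two columns are the images of [u] and [v] projected
    to the tangent plane at [p]. *)
Lemma orient_linear p u v (r s t : R) (M : 'M[R]_3) x :
  r != 0 -> M *m val x = r *: p ->
  \det (row_mx p (row_mx (M *m u - s *: p) (M *m v - t *: p)) : 'M[R]_3) =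
  r^-1 * (\det M * orient x u v).
Proof.
move=> r0 Mx; have -> : p = r^-1 *: (M *m val x).
  by rewrite Mx scalerA mulVf// scale1r.
have -> : \det M * orient x u v =
    \det (row_mx (M *m val x) (row_mx (M *m u) (M *m v)) : 'M[R]_3).
  rewrite -(mul_mx_row _ u v) -[row_mx (_ *m _) _]mul_mx_row.
  by rewrite -[RHS]/(\det (M *m _)) det_mulmx.
move: (M *m val x) (M *m u) (M *m v) => a b c.
by rewrite !det_col3 !mxE; ring.
Qed.

Lemma orientation_preserving_linS2 f (M : 'M[R]_3) : 0 < \det M ->
  smoothS2 f -> orientation_preserving f -> orientation_preserving (f \o linS2 M).
Proof.
move=> dM sf orf x u v xu xv uv.
have uM : M \in unitmx by rewrite unitmxE unitfE lt0r_neq0.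
have Mx0 := unitmx_mul_neq0 uM (S2_neq0 x).
rewrite !tdiff_linS2//.
have r0 := enorm_gt0 Mx0; have := radialE Mx0.
rewrite -/(linS2 M x); move: (enorm _) r0 => r r0 /esym Mx.
rewrite Mx !derive_extendZ ?S2_neq0// !derive_extend_tangent//=.
set u' := _ - _; set v' := _ - _.
(* The projected images [u'] and [v'] form a positive basis at [linS2 M x], to which the hypothesis
   on [f] applies; the two factors [r^-1] left by homogeneity are positive. *)
have : 0 < orient (f (linS2 M x)) (tdiff f (linS2 M x) u') (tdiff f (linS2 M x) v').
  apply: orf; [exact: tangent_decomp|exact: tangent_decomp|].
  by rewrite /orient (orient_linear _ _ _ _ (lt0r_neq0 r0) Mx) !mulr_gt0 ?invr_gt0.
rewrite /orient; move: (val (f _)) (tdiff _ _ _) (tdiff _ _ _) => a c b abc.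
have -> : \det (row_mx a (row_mx (r^-1 *: b) (r^-1 *: c)) : 'M[R]_3) =
    r^-1 * (r^-1 * \det (row_mx a (row_mx b c) : 'M[R]_3)).
  by rewrite !det_col3 !mxE; ring.
by rewrite !mulr_gt0 ?invr_gt0.
Qed.

Lemma Omega_linS2 f (M : 'M[R]_3) : 0 < \det M -> Omega R f -> Omega R (f \o linS2 M).
Proof.
move=> dM [[sf [g [sg fg gf]]] orf].
have uM : M \in unitmx by rewrite unitmxE unitfE lt0r_neq0.
have uMi : invmx M \in unitmx by rewrite unitmx_inv.
split; last exact: orientation_preserving_linS2.
split; first exact: smoothS2_linS2.
exists (linS2 (invmx M) \o g); split.
- rewrite -[linS2 (invmx M)]/((fun z => z) \o linS2 (invmx M)).
  have sM : smoothS2 (fun z => linS2 (invmx M) z).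
    by apply: (smoothS2_linS2 (f := fun z => z)) => //; exact: smoothS2_id.
  exact: smoothS2_comp.
- by move=> x /=; rewrite fg linS2K.
- by move=> x /=; rewrite linS2VK.
Qed.

End frames.

(** * Gram-Schmidt on the differential at the south pole *)

Section gram_schmidt.
Context {R : realType}.
Implicit Types (u v w y p : 'cV[R]_3) (x : S2 R) (f : S2 R -> S2 R).

Lemma dotC u v : dot u v = dot v u.
Proof. by rewrite !dot3; ring. Qed.

(** Nested as in [orient], so that orientations are determinants of such matrices by conversion. *)
Definition col3 u v w : 'M[R]_3 := row_mx u (row_mx v w).

Lemma col3_mulE u v w y :
  col3 u v w *m y = y 0 0 *: u + y 1 0 *: v + y 2%:R 0 *: w.
Proof.
apply/matrixP => i j; rewrite ord1 !mxE !big_ord_recl big_ord0.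
have -> : col3 u v w i ord0 = u i 0.
  rewrite (_ : ord0 = @lshift 1 2 0); last exact: val_inj.
  by rewrite (row_mxEl u).
have -> : col3 u v w i (lift ord0 ord0) = v i 0.
  rewrite (_ : lift ord0 ord0 = @rshift 1 2 (@lshift 1 1 0)); last exact: val_inj.
  by rewrite (row_mxEr u) (row_mxEl v).
have -> : col3 u v w i (lift ord0 (lift ord0 ord0)) = w i 0.
  rewrite (_ : lift _ _ = @rshift 1 2 (@rshift 1 1 0)); last exact: val_inj.
  by rewrite (row_mxEr u) (row_mxEr v).
have -> : lift ord0 ord0 = 1 :> 'I_3 by exact: val_inj.
have -> : lift ord0 (lift ord0 ord0) = 2%:R :> 'I_3 by exact: val_inj.
by rewrite addr0 addrA -!(mulrC (y _ _)).
Qed.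

Lemma col3_orthogonal u v w :
  dot u u = 1 -> dot v v = 1 -> dot w w = 1 ->
  dot u v = 0 -> dot u w = 0 -> dot v w = 0 ->
  (col3 u v w)^T *m col3 u v w = 1%:M.
Proof.
have tE (a b : 'cV[R]_3) : a^T *m b = (dot a b)%:M.
  by rewrite dotE; exact: mx11_scalar.
move=> uu vv ww uv uw vw.
rewrite [LHS](_ : _ = (row_mx u (row_mx v w))^T *m row_mx u (row_mx v w))//.
rewrite (tr_row_mx u) (tr_row_mx v) (mul_col_row (u^T)) mul_mx_row mul_col_mx.
rewrite (mul_col_row (v^T)) !tE uu vv ww uv uw vw (dotC v u) (dotC w u) (dotC w v) uv uw vw.
rewrite [RHS](scalar_mx_block 1 2) (scalar_mx_block 1 1).
by rewrite !raddf0 (row_mx0 _ 1 1 1) (col_mx0 _ 1 1 1).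
Qed.

(** The squared determinant is the Gram determinant of the three columns; for a unit normal [p] it
    reduces to EG - F^2. *)
Lemma gram_det3 p u v : dot p p = 1 -> dot p u = 0 -> dot p v = 0 ->
  \det (col3 p v u) ^+ 2 = dot u u * dot v v - dot u v ^+ 2.
Proof.
move=> pp pu pv.
have -> : \det (col3 p v u) ^+ 2 =
  dot p p * (dot u u * dot v v - dot u v ^+ 2)
  - dot p u * (dot p u * dot v v - dot u v * dot p v)
  - dot p v * (dot p v * dot u u - dot u v * dot p u).
  by rewrite /col3 det_col3 !dot3; ring.
by rewrite pp pu pv; ring.
Qed.

Definition e0 : 'cV[R]_3 := delta_mx 0 0.
Definition e1 : 'cV[R]_3 := delta_mx 1 0.

Lemma tangent_south_pole u : tangent south_pole u <-> u 2%:R 0 = 0.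
Proof.
rewrite /tangent dot3 !mxE /= !mul0r !add0r mulN1r.
by split=> [/eqP|->]; rewrite ?oppr0// oppr_eq0 => /eqP.
Qed.

Lemma tangent_e0 : tangent south_pole e0.
Proof. by apply/tangent_south_pole; rewrite mxE. Qed.

Lemma tangent_e1 : tangent south_pole e1.
Proof. by apply/tangent_south_pole; rewrite mxE. Qed.

(* The outward normal at the south pole is -e2, so (e1, e0) is the positive basis. *)
Lemma orient_e1_e0 : orient south_pole e1 e0 = 1.
Proof. by rewrite /orient det_col3 !mxE /=; ring. Qed.

(** Upper triangular on the plane of [e0] and [e1], and the identity on the polar axis. *)
Definition shear (a b c : R) : 'M[R]_3 :=
  col3 (a *: e0) (b *: e0 + c *: e1) (delta_mx 2%:R 0).

Lemma shearE a b c y : shear a b c *m y =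
  (y 0 0 * a + y 1 0 * b) *: e0 + (y 1 0 * c) *: e1 + y 2%:R 0 *: delta_mx 2%:R 0.
Proof. by rewrite col3_mulE scalerDr !scalerA addrA scalerDl. Qed.

Lemma det_shear a b c : \det (shear a b c) = a * c.
Proof. by rewrite det_col3 !mxE /=; ring. Qed.

Lemma shear_south_pole a b c : shear a b c *m val south_pole = val south_pole.
Proof.
rewrite shearE; apply/matrixP => i j; rewrite ord1 !mxE /=.
by case: i => [[|[|[|]]]]//= ?; rewrite ?mxE/=; ring.
Qed.

Lemma shear1 : shear 1 0 1 = 1%:M.
Proof.
have sK y : shear 1 0 1 *m y = y.
  rewrite shearE; apply/matrixP => i j; rewrite ord1 !mxE mulr1 mulr0 addr0.
  have [->|->|->] : [\/ i = 0, i = 1 | i = 2%:R].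
    by case: i => [[|[|[|]]]]//= ?;
      [constructor 1|constructor 2|constructor 3]; exact: val_inj.
  - by rewrite /=; ring.
  - by rewrite /=; ring.
  - by rewrite /=; ring.
apply/matrixP => i j; have /colP/(_ i) := sK (delta_mx j 0).
by rewrite -colE !mxE andbT.
Qed.

(** The extension of [f] has constant squared length 1; differentiating this gives the
    orthogonality. *)
Lemma dot_tdiff f x u : smoothS2 f -> dot (val (f x)) (tdiff f x u) = 0.
Proof.
move=> sf; have de := differentiable_extend sf (S2_neq0 x).
have : 'D_u ((fun y => dot y y) \o extend f) (val x) = 0.
  rewrite (_ : _ \o _ = cst 1) ?derive_cst//.
  by apply/funext => y; exact/eqP/(valP (f _)).
rewrite deriveE; last by apply: differentiable_comp => //; exact: differentiable_dot.
rewrite diff_comp//=; last exact: differentiable_dot.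
rewrite -deriveE; last exact: differentiable_dot.
rewrite derive_dot /extend radialK -deriveE// => /eqP.
by rewrite mulrn_eq0/= => /eqP.
Qed.

Definition du f := tdiff f south_pole e0.
Definition dv f := tdiff f south_pole e1.

Definition gram_E f := dot (du f) (du f).
Definition gram_F f := dot (du f) (dv f).
Definition area f := orient (f south_pole) (dv f) (du f).

(* The Gram-Schmidt matrix; [area f] is the square root of EG - F^2. *)
Definition gs0 f := (Num.sqrt (gram_E f))^-1.
Definition gs1 f := - gram_F f * ((Num.sqrt (gram_E f))^-1 * (area f)^-1).
Definition gs2 f := Num.sqrt (gram_E f) * (area f)^-1.

(** The segment from the identity to the Gram-Schmidt matrix, written entry by entry so that it
    stays a [shear]. *)
Definition frame_path (t : R) f : 'M[R]_3 :=
  shear ((1 - t) + t * gs0 f) (t * gs1 f) ((1 - t) + t * gs2 f).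

(** The candidate rotation: the first two columns are the orthonormalized images of [e0] and [e1].
    The last is the image of the third basis vector, which is the opposite of the south pole. *)
Definition frame f := col3 (gs0 f *: du f) (gs1 f *: du f + gs2 f *: dv f)
  (- val (f south_pole)).

Lemma area_gt0 f : Omega R f -> 0 < area f.
Proof.
move=> [_ orf]; apply: orf; [exact: tangent_e1|exact: tangent_e0|].
by rewrite orient_e1_e0 ltr01.
Qed.

(** If [du f] were zero, the positive [area f] would be a determinant with a zero column. *)
Lemma gram_E_gt0 f : Omega R f -> 0 < gram_E f.
Proof.
move=> /area_gt0 af; apply: dot_gt0; apply: contraTneq af => du0.
by rewrite /area /orient du0 det_col3 !mxE !mulr0 !subrr !mulr0 subrr addr0 ltxx.
Qed.

Lemma gs0_gt0 f : Omega R f -> 0 < gs0 f.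
Proof. by move=> Of; rewrite invr_gt0 sqrtr_gt0 gram_E_gt0. Qed.

Lemma gs2_gt0 f : Omega R f -> 0 < gs2 f.
Proof.
by move=> Of; rewrite mulr_gt0 ?invr_gt0 ?area_gt0// sqrtr_gt0 gram_E_gt0.
Qed.

Lemma det_frame_path_gt0 (t : R) f : 0 <= t <= 1 -> Omega R f ->
  0 < \det (frame_path t f).
Proof.
move=> /andP[t0 t1] Of; have := gs0_gt0 Of; have := gs2_gt0 Of.
rewrite det_shear => c0 a0.
(* A convex combination of 1 and a positive number is positive; at [t = 0] the second term vanishes,
   hence the case split. *)
have h a : 0 < a -> 0 < 1 - t + t * a.
  move=> {}a0; have [->|tn0] := eqVneq t 0; first by rewrite subr0 mul0r addr0.
  by apply: ltr_wpDl; [rewrite subr_ge0|rewrite mulr_gt0// lt_neqAle eq_sym tn0].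
by rewrite mulr_gt0 ?h.
Qed.

Lemma frame_path0 f : frame_path 0 f = 1%:M.
Proof. by rewrite /frame_path !mul0r subr0 addr0 shear1. Qed.

(** The frame [(e0, e1)] is already orthonormal, so the segment is constant. With invariance under
    rotations, this is what keeps every rotation fixed. *)
Lemma frame_path_id (t : R) : frame_path t (fun x => x) = 1%:M.
Proof.
have u0 : du (fun x => x) = e0 by exact/tdiff_id/tangent_e0.
have v0 : dv (fun x => x) = e1 by exact/tdiff_id/tangent_e1.
rewrite /frame_path /gs0 /gs1 /gs2 /gram_E /gram_F /area u0 v0 orient_e1_e0.
have -> : dot e0 e0 = 1 by rewrite dot3 !mxE /=; ring.
have -> : dot e0 e1 = 0 by rewrite dot3 !mxE /=; ring.
by rewrite sqrtr1 !invr1 oppr0 mul0r !mulr0 !mulr1 subrK shear1.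
Qed.

Lemma frame_path_rot (t : R) A f : smoothS2 f ->
  frame_path t (rotS2 A \o f) = frame_path t f.
Proof.
move=> sf; rewrite /frame_path /gs0 /gs1 /gs2 /gram_E /gram_F /area.
have -> : du (rotS2 A \o f) = val A *m du f by exact: tdiff_rotS2.
have -> : dv (rotS2 A \o f) = val A *m dv f by exact: tdiff_rotS2.
move: (du f) (dv f) => u v.
by rewrite (dot_rot A u u) (dot_rot A u v) (orient_rotS2 A (f south_pole) v u).
Qed.

(** Here [s] is the length of [u] and [d] the area of the parallelogram on [u] and [v]. The columns
    are the Gram-Schmidt vectors of [(u, v)], completed by [- p] for the sake of orientation. *)
Lemma gram_schmidt_SO3 p u v (s d : R) (F := dot u v) :
  dot p p = 1 -> dot p u = 0 -> dot p v = 0 -> 0 < s -> dot u u = s ^+ 2 ->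
  0 < d -> d = \det (col3 p v u) ->
  let B := col3 (s^-1 *: u) (- F * (s^-1 * d^-1) *: u + (s * d^-1) *: v) (- p) in
  (B^T *m B == 1%:M) && (\det B == 1).
Proof.
move=> pp pu pv s0 uu d0 dE /=.
(* The Gram identity d^2 = s^2 G - F^2, solved for G; every inner product of the columns then
   becomes a rational function of [s], [d] and [F]. *)
have G : dot v v = (d ^+ 2 + F ^+ 2) / s ^+ 2.
  by have := gram_det3 pp pu pv; rewrite -dE uu -/F => ->; field; rewrite lt0r_neq0.
have sn0 := lt0r_neq0 s0; have dn0 := lt0r_neq0 d0.
set a := s^-1; set b := - F * _; set c := s * _.
have h1 : dot (a *: u) (a *: u) = a ^+ 2 * dot u u by rewrite !dot3 !mxE; ring.
have h2 : dot (b *: u + c *: v) (b *: u + c *: v) =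
  b ^+ 2 * dot u u + 2 * b * c * dot u v + c ^+ 2 * dot v v.
  by rewrite !dot3 !mxE; ring.
have h3 : dot (- p) (- p) = dot p p by rewrite !dot3 !mxE; ring.
have h4 : dot (a *: u) (b *: u + c *: v) = a * (b * dot u u + c * dot u v).
  by rewrite !dot3 !mxE; ring.
have h5 : dot (a *: u) (- p) = - a * dot p u by rewrite !dot3 !mxE; ring.
have h6 : dot (b *: u + c *: v) (- p) = - (b * dot p u + c * dot p v).
  by rewrite !dot3 !mxE; ring.
have h7 : \det (col3 (a *: u) (b *: u + c *: v) (- p)) = a * c * \det (col3 p v u).
  by rewrite /col3 !det_col3 !mxE; ring.
apply/andP; split; apply/eqP.
  apply: col3_orthogonal.
  - by rewrite h1 uu /a; field.
  - by rewrite h2 uu G -/F /b /c /a; field; rewrite ?sn0 ?dn0.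
  - by rewrite h3 pp.
  - by rewrite h4 uu -/F /b /c /a; field; rewrite ?sn0 ?dn0.
  - by rewrite h5 pu mulr0.
  - by rewrite h6 pu pv !mulr0 addr0 oppr0.
by rewrite h7 -dE /a /c; field; rewrite ?sn0 ?dn0.
Qed.

Lemma frame_SO3 f : Omega R f ->
  ((frame f)^T *m frame f == 1%:M) && (\det (frame f) == 1).
Proof.
move=> Of; have [[sf _] _] := Of; have E0 := gram_E_gt0 Of.
apply: gram_schmidt_SO3.
- exact/eqP/(valP (f _)).
- exact: dot_tdiff.
- exact: dot_tdiff.
- by rewrite sqrtr_gt0.
- by rewrite sqr_sqrtr// ltW.
- exact: area_gt0.
- by [].
Qed.

End gram_schmidt.

(** * The end of the path at the south pole *)

Section end_point.
Context {R : realType}.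
Implicit Types (f : S2 R -> S2 R).

Lemma linS2_frame_path_pole (t : R) f : linS2 (frame_path t f) south_pole = south_pole.
Proof. by rewrite /linS2 shear_south_pole radialK. Qed.

Lemma linS2_1 : linS2 (1%:M : 'M[R]_3) = id.
Proof. by apply/funext => x; rewrite /linS2 mul1mx radialK. Qed.

Lemma frame_south_pole f : frame f *m val south_pole = val (f south_pole).
Proof.
rewrite /frame col3_mulE !mxE /= !scale0r !add0r.
by rewrite scaleNr scale1r opprK.
Qed.

(** The matrix fixes the pole without rescaling, so the differential is that of [f] applied to the
    sheared vector. Tangency kills the third coordinate, and linearity yields the first two columns
    of [frame f]. *)
Lemma tdiff_frame_path1 f u : Omega R f -> tangent south_pole u ->
  tdiff (f \o linS2 (frame_path 1 f)) south_pole u = frame f *m u.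
Proof.
move=> Of /tangent_south_pole u2; have [[sf _] _] := Of.
have dM : 0 < \det (frame_path 1 f) by apply: det_frame_path_gt0; rewrite ?ler01 ?lexx.
have de := differentiable_extend sf (S2_neq0 south_pole).
rewrite tdiff_linS2 ?unitmxE ?unitfE ?lt0r_neq0// shear_south_pole.
rewrite shearE col3_mulE u2 !scale0r !addr0 subrr !add0r !mul1r.
rewrite deriveE// linearD !linearZ/= -!deriveE//.
rewrite -[LHS]/(_ *: du f + _ *: dv f).
move: (du f) (dv f) (gs0 f) (gs1 f) (gs2 f) => v w a b c.
by rewrite scalerDl scalerDr !scalerA addrA (mulrC a).
Qed.

End end_point.

(** * Smooth dependence of dot products, determinants and shears *)

Section smooth_families.
Context {R : realType} (V : normedModType R).
Implicit Types (z : V).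

Lemma smooth_at_dot z (a b : V -> 'cV[R]_3) :
  smooth_at z a -> smooth_at z b -> smooth_at z (fun y => dot (a y) (b y)).
Proof.
move=> sa sb; apply: smooth_at_sum => i.
by apply: smooth_at_mul; exact: smooth_at_coord.
Qed.

Lemma smooth_at_opp (W : normedModType R) z (a : V -> W) :
  smooth_at z a -> smooth_at z (fun y => - a y).
Proof.
move=> sa; apply: (smooth_at_eq (f := fun y => (-1 : R) *: a y)).
  by apply: nearW => y; rewrite scaleN1r.
by apply: smooth_at_scale => //; exact: smooth_at_cst.
Qed.

Lemma smooth_at_det_col3 z (a b c : V -> 'cV[R]_3) :
  smooth_at z a -> smooth_at z b -> smooth_at z c ->
  smooth_at z (fun y => \det (col3 (a y) (b y) (c y))).
Proof.
move=> sa sb sc; have sM (g h : V -> R) := @smooth_at_mul R V g h z.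
have sB (g h : V -> R) : smooth_at z g -> smooth_at z h -> smooth_at z (fun y => g y - h y).
  by move=> sg sh; apply: smooth_at_add => //; exact: smooth_at_opp.
apply: (smooth_at_eq (f := fun y =>
  a y 0 0 * (b y 1 0 * c y 2%:R 0 - b y 2%:R 0 * c y 1 0)
  - a y 1 0 * (b y 0 0 * c y 2%:R 0 - b y 2%:R 0 * c y 0 0)
  + a y 2%:R 0 * (b y 0 0 * c y 1 0 - b y 1 0 * c y 0 0))).
  by apply: nearW => y; rewrite /col3 det_col3.
apply: smooth_at_add; first apply: (sB);
  by apply: (sM); [exact: smooth_at_coord|];
  apply: (sB); apply: (sM); exact: smooth_at_coord.
Qed.

Lemma smooth_at_shear z (a b c : V -> R) (y : V -> 'cV[R]_3) :
  smooth_at z a -> smooth_at z b -> smooth_at z c -> smooth_at z y ->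
  smooth_at z (fun s => shear (a s) (b s) (c s) *m y s).
Proof.
move=> sa sb sc sy.
apply: (smooth_at_eq (f := fun s => (y s 0 0 * a s + y s 1 0 * b s) *: e0
  + (y s 1 0 * c s) *: e1 + y s 2%:R 0 *: delta_mx 2%:R 0)).
  by apply: nearW => s; rewrite shearE.
have sy' i := smooth_at_coord i 0 sy.
apply: smooth_at_add; last by apply: smooth_at_scale => //; exact: smooth_at_cst.
apply: smooth_at_add; apply: smooth_at_scale; try exact: smooth_at_cst.
  by apply: smooth_at_add; apply: smooth_at_mul.
by apply: smooth_at_mul.
Qed.

End smooth_families.

(** * The deformation sends plots to plots *)

Section plots.
Context {R : realType}.

Lemma near_section (V W : normedModType R) (P : V * W -> Prop) (x : V) (y : W) :
  (\forall z \near (x, y), P z) -> \forall s \near x, \forall w \near y, P (s, w).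
Proof.
move=> [[A B] /= [nA nB] AB]; apply: filterS nA => s As.
by apply: filterS nB => w Bw; exact: AB.
Qed.

(** A partial derivative is a directional derivative of the joint map, hence smooth in the parameter
    as well. *)
Lemma derive_section (V W Z : normedModType R) (h : V * W -> Z) s w v :
  'D_v (fun y => h (s, y)) w = 'D_(0, v) h (s, w).
Proof.
rewrite /derive; apply: (congr1 (fun g : R -> Z => lim (g @ 0^'))); apply/funext => t /=.
congr (_ *: (h _ - _)).
by rewrite [RHS]surjective_pairing /= scaler0 add0r.
Qed.

Section family.
Context (n : nat) (U : set 'rV[R]_n) (T : U -> I01 R) (F : U -> Omega R).
Hypothesis sT : mfd_plots (fun t : I01 R => val t : R^o) T.
Hypothesis sF : Omega_plots F.

(** A family over the subtype [U] has no derivatives of its own; near [s0] it is replaced by a map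
    on the ambient space. *)
Definition local_extension (W : Type) (s0 : U) (a : U -> W) (b : 'rV[R]_n -> W) :=
  \forall z \near (val s0 : 'rV[R]_n), forall s : U, val s = z -> a s = b z.

Lemma extend_family (s0 : U) y : y != 0 ->
  exists2 h : 'rV[R]_n * 'cV[R]_3 -> 'cV[R]_3, smooth_at (val s0 : 'rV[R]_n, y) h &
    \forall z \near (val s0 : 'rV[R]_n, y),
      forall s : U, val s = z.1 -> extend (val (F s)) z.2 = h z.
Proof.
move=> y0; have /smooth_alongP/(_ (s0, radial y))[g sg gF] := sF.
have sr : smooth_at (val s0 : 'rV[R]_n, y)
    (fun z : 'rV[R]_n * 'cV[R]_3 => (z.1, val (radial z.2))).
  apply: smooth_at_pair; first exact/smooth_at_fst/smooth_at_id.
  apply: (smooth_at_comp (h := fun z => val (radial z))).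
  - exact: finite_coordinates_mx.
  - exact: smooth_at_radial.
  - exact/smooth_at_snd/smooth_at_id.
exists (fun z => g (z.1, val (radial z.2))).
  apply: smooth_at_comp sg sr.
  by apply: finite_coordinates_prod; exact: finite_coordinates_mx.
have := smooth_at_near sr gF; apply: filterS => z gz s sz.
by rewrite -(gz (s, radial z.2)) //= sz.
Qed.

(** The differential at the pole is a partial derivative of the jointly smooth map of
    [extend_family], restricted to the pole. *)
Lemma tdiff_family (s0 : U) u : exists2 d, smooth_at (val s0 : 'rV[R]_n) d &
  local_extension s0 (fun s => tdiff (val (F s)) south_pole u) d.
Proof.
have [h sh hF] := extend_family s0 (S2_neq0 (@south_pole R)).
exists (fun z => 'D_(0, u) h (z, val (@south_pole R))).
  apply: (smooth_at_comp (h := 'D_(0, u) h) (g := fun z => (z, val (@south_pole R)))).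
  - by apply: finite_coordinates_prod; exact: finite_coordinates_mx.
  - exact: smooth_at_derive.
  - by apply: smooth_at_pair; [exact: smooth_at_id|exact: smooth_at_cst].
apply: filterS (near_section hF) => z hz s sz; rewrite -derive_section.
by apply: near_eq_derive; apply: filterS hz => y; exact.
Qed.

Lemma pole_family (s0 : U) : exists2 d, smooth_at (val s0 : 'rV[R]_n) d &
  local_extension s0 (fun s => val (val (F s) south_pole)) d.
Proof.
have [h sh hF] := extend_family s0 (S2_neq0 (@south_pole R)).
exists (fun z => h (z, val (@south_pole R))).
  apply: (smooth_at_comp (h := h) (g := fun z => (z, val (@south_pole R)))) => //.
  - by apply: finite_coordinates_prod; exact: finite_coordinates_mx.
  - by apply: smooth_at_pair; [exact: smooth_at_id|exact: smooth_at_cst].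
apply: filterS (near_section hF) => z hz s sz.
by rewrite -(nbhs_singleton hz s sz) /extend radialK.
Qed.

Lemma frame_family (s0 : U) : exists a b c : 'rV[R]_n -> R,
  [/\ smooth_at (val s0 : 'rV[R]_n) a, smooth_at (val s0 : 'rV[R]_n) b,
      smooth_at (val s0 : 'rV[R]_n) c &
    local_extension s0 (fun s => frame_path (val (T s)) (val (F s)))
                       (fun z => shear (a z) (b z) (c z))].
Proof.
have /smooth_alongP/(_ s0)[t st tT] := sT.
have [u su uF] := tdiff_family s0 e0.
have [v sv vF] := tdiff_family s0 e1.
have [p sp pF] := pole_family s0.
have OF s := set_mem (valP (F s)).
pose E z := dot (u z) (u z).
pose d z := \det (col3 (p z) (v z) (u z)).
have sE : smooth_at (val s0 : 'rV[R]_n) E by exact: smooth_at_dot.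
have sd : smooth_at (val s0 : 'rV[R]_n) d by exact: smooth_at_det_col3.
(* At [val s0] the ambient maps take the values of the family, so [E] and [d] are positive there and
   their roots and inverses are smooth nearby. *)
have E0 : 0 < E (val s0).
  by rewrite /E -(nbhs_singleton uF s0 erefl) gram_E_gt0.
have d0 : d (val s0) != 0.
  rewrite /d -(nbhs_singleton uF s0 erefl) -(nbhs_singleton vF s0 erefl).
  by rewrite -(nbhs_singleton pF s0 erefl) lt0r_neq0// area_gt0.
have ss := smooth_at_sqrt E0 sE.
have si : smooth_at (val s0 : 'rV[R]_n) (fun z => (Num.sqrt (E z))^-1).
  by apply: smooth_at_inv => //; rewrite lt0r_neq0// sqrtr_gt0.
have di := smooth_at_inv d0 sd.
have c1 : smooth_at (val s0 : 'rV[R]_n) (fun=> 1 : R) by exact: smooth_at_cst.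
have t1 : smooth_at (val s0 : 'rV[R]_n) (fun z => 1 - t z).
  by apply: smooth_at_add => //; exact: smooth_at_opp.
exists (fun z => 1 - t z + t z * (Num.sqrt (E z))^-1),
  (fun z => t z * (- dot (u z) (v z) * ((Num.sqrt (E z))^-1 * (d z)^-1))),
  (fun z => 1 - t z + t z * (Num.sqrt (E z) * (d z)^-1)).
split.
- by apply: smooth_at_add => //; exact: smooth_at_mul.
- apply: smooth_at_mul => //; apply: smooth_at_mul; last exact: smooth_at_mul.
  by apply: smooth_at_opp; exact: smooth_at_dot.
- by apply: smooth_at_add => //; apply: smooth_at_mul => //; exact: smooth_at_mul.
near=> z => s sz.
have tz : val (T s) = t z.
  by move: s sz; near: z.
have uz : du (val (F s)) = u z by move: s sz {tz}; near: z.
have vz : dv (val (F s)) = v z by move: s sz {tz uz}; near: z.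
have pz : val (val (F s) south_pole) = p z by move: s sz {tz uz vz}; near: z.
have Ez : gram_E (val (F s)) = E z by rewrite /gram_E uz.
have dz : area (val (F s)) = d z by rewrite /area /orient uz vz pz.
by rewrite /frame_path /gs0 /gs1 /gs2 Ez dz /gram_F uz vz tz.
Unshelve. all: by end_near. Qed.

Lemma smooth_along_frame_path :
  smooth_along (fun sx : U * S2 R => (val sx.1, val sx.2))
    (fun sx => val (val (F sx.1) (linS2 (frame_path (val (T sx.1)) (val (F sx.1))) sx.2))).
Proof.
apply/smooth_alongP => -[s0 x0] /=.
have [a [b [c [sa sb sc abcF]]]] := frame_family s0.
pose M z := shear (a z) (b z) (c z).
have s1 : smooth_at (val s0 : 'rV[R]_n, val x0) (fun z : 'rV[R]_n * 'cV[R]_3 => z.1).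
  exact/smooth_at_fst/smooth_at_id.
have s2 : smooth_at (val s0 : 'rV[R]_n, val x0) (fun z : 'rV[R]_n * 'cV[R]_3 => z.2).
  exact/smooth_at_snd/smooth_at_id.
have s1f (g : 'rV[R]_n -> R) : smooth_at (val s0 : 'rV[R]_n) g ->
    smooth_at (val s0 : 'rV[R]_n, val x0) (fun z : 'rV[R]_n * 'cV[R]_3 => g z.1).
  by move=> sg; apply: smooth_at_comp => //; exact: finite_coordinates_mx.
have sM : smooth_at (val s0 : 'rV[R]_n, val x0) (fun z : 'rV[R]_n * 'cV[R]_3 => M z.1 *m z.2).
  by apply: smooth_at_shear => //; exact: s1f.
(* This point is in general off the sphere, but nonzero, so the family of extensions is smooth
   around it and no normalization intervenes. *)
have Mx0 : M (val s0) *m val x0 != 0.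
  rewrite /M -(nbhs_singleton abcF s0 erefl); apply: unitmx_mul_neq0 (S2_neq0 x0).
  rewrite unitmxE unitfE lt0r_neq0// det_frame_path_gt0//; last exact/set_mem/valP.
  by have := set_mem (valP (T s0)); rewrite /= in_itv.
have [h sh hF] := extend_family s0 Mx0.
have s1M := smooth_at_pair s1 sM.
exists (fun z => h (z.1, M z.1 *m z.2)).
  apply: (smooth_at_comp (h := h)) s1M => //.
  by apply: finite_coordinates_prod; exact: finite_coordinates_mx.
have hM := smooth_at_near s1M hF; have fM := smooth_at_near s1 abcF.
apply: filterS2 hM fM => z hz Mz [s x] /= sxz.
rewrite -sxz/= in hz Mz *.
(* By conversion, [extend f (M *m val x)] is the value of [f] at [linS2 M x]. *)
by rewrite -(hz s erefl)/= /M -(Mz s erefl).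
Qed.

End family.
End plots.

(** * The deformation and its four properties *)

Definition stretch_path {R : realType} (tf : I01 R * Omega R) : Omega R.
Proof.
exists (val tf.2 \o linS2 (frame_path (val tf.1) (val tf.2))).
apply: mem_set; apply: Omega_linS2; last exact/set_mem/valP.
apply: det_frame_path_gt0; last exact/set_mem/valP.
by have := set_mem (valP tf.1); rewrite /= in_itv.
Defined.

Theorem theorem1p7 (R : realType) :
  exists Q : I01 R * Omega R -> Omega R,
    diff_smooth I01_Omega_plots Omega_plots Q /\
    forall (t : I01 R) (f : Omega R) (A : SO3 R),
      [/\ Q (i0, f) = f,
          range i_map (Q (i1, f)),
          Q (t, SO3_Omega A) = SO3_Omega A &
          Q (t, rot_comp A f) = rot_comp A (Q (t, f))].
Proof.
exists stretch_path; split.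
  move=> n U oU P [sT sF].
  exact: (smooth_along_frame_path sT sF).
move=> t f A; have Of : Omega R (val f) by exact/set_mem/valP.
have [[sf _] _] := Of; split.
- by apply: val_inj; rewrite /= frame_path0 linS2_1.
(* [B] agrees with [Q1] at the pole to first order, so its inverse composed with [Q1] lies in
   [Omega1]. As [i_map] inverts its rotation, the witness is [A'], the inverse of [B]. *)
- pose B : SO3 R := exist _ (frame (val f)) (frame_SO3 Of).
  pose Q1 := stretch_path (i1, f).
  have OQ : Omega R (val Q1) by exact/set_mem/valP.
  pose A' := SO3_inv B.
  pose g : Omega R := rot_comp A' Q1.
  have Og : Omega1 R g.
    split.
      rewrite /= linS2_frame_path_pole -[LHS]/(rotS2 A' (val f south_pole)).
      by rewrite -[RHS](rotS2K B); congr rotS2; apply: val_inj; rewrite /= frame_south_pole.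
    move=> u xu.
    have uB : val B \in unitmx by rewrite unitmxE (SO3_det B) unitr1.
    have ABu : val A' *m (val B *m u) = u by rewrite mulmxA mulVmx// mul1mx.
    have Qu : tdiff (val Q1) south_pole u = val B *m u.
      exact: (tdiff_frame_path1 Of xu).
    have sQ : smoothS2 (val Q1) by have [[]] := OQ.
    have Au := tdiff_rotS2 A' south_pole u sQ.
    exact: etrans Au (etrans (congr1 (mulmx (val A')) Qu) ABu).
  exists (A', exist _ g (mem_set Og)) => //.
  by apply: val_inj; apply/funext => x; rewrite -[RHS](rotS2K A' (val Q1 x)).
(* A rotation is its own composite with the identity, whose path of matrices is constant. *)
- have -> : SO3_Omega A = rot_comp A (exist _ (fun x => x) (mem_set Omega_id)).
    exact: val_inj.
  apply: val_inj; rewrite /= frame_path_rot; last exact: smoothS2_id.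
  by rewrite frame_path_id linS2_1.
- by apply: val_inj; rewrite /= frame_path_rot.
Qed.
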